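(* Let $L$ (logical system) and $S$ (physical system) be finite-dimensional quantum systems, let $\mathcal{E}_{S\leftarrow L}$ be an isometric encoding channel, and let $\mathcal{N}_S(\cdot)=\sum_i K_{S,i}(\cdot)K_{S,i}^\dagger$ be a noise channel on $S$. Let $H_L$ and $H_S$ be non-trivial Hermitian operators (Hamiltonians) on $L$ and $S$, defining the $U(1)$ actions $U_{L,\theta}=e^{-iH_L\theta}$, $U_{S,\theta}=e^{-iH_S\theta}$, $\theta\in\mathbb{R}$, and assume the Hamiltonian-in-Kraus-span condition $H_S\in\mathrm{span}\{K_{S,i}^\dagger K_{S,j}\}_{i,j}$. Then $$\delta_{\mathrm{G}} \gtrsim \sqrt{\frac{\Delta H_L - 2\epsilon\,\mathfrak{J}}{\Delta H_S}},$$ where $\delta_{\mathrm{G}}$, $\epsilon$, $\mathfrak{J}$, $\Delta$ and $\gtrsim$ are as defined in the context.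
   Context: For a unitary $U$, $\mathcal{U}(\cdot):=U(\cdot)U^\dagger$. For states, fidelity $f(\rho,\sigma)=\mathrm{Tr}\sqrt{\rho^{1/2}\sigma\rho^{1/2}}$ and purified distance $P(\rho,\sigma)=\sqrt{1-f(\rho,\sigma)^2}$. For channels, $P(\Phi_1,\Phi_2)=\max_\rho P((\Phi_1\otimes\mathbb{1})(\rho),(\Phi_2\otimes\mathbb{1})(\rho))$, maximized over states on the input system together with a reference system. For a Hermitian operator $X$, $\Delta X$ denotes its largest eigenvalue minus its smallest eigenvalue. QEC inaccuracy: $\epsilon:=\min_{\mathcal{R}_{L\leftarrow S}}P(\mathcal{R}_{L\leftarrow S}\circ\mathcal{N}_S\circ\mathcal{E}_{S\leftarrow L},\mathbb{1}_L)$, minimized over recovery channels $\mathcal{R}_{L\leftarrow S}$. Global covariance violation: $\delta_{\mathrm{G}}:=\max_{\theta}P(\mathcal{U}_{S,\theta}\circ\mathcal{E}_{S\leftarrow L},\mathcal{E}_{S\leftarrow L}\circ\mathcal{U}_{L,\theta})$. $\mathfrak{J}:=\min_{h\in\mathbb{H}}\Delta h$, where $\mathbb{H}$ is the set of Hermitian matrices $h=(h_{ij})$ with $H_S=\sum_{ij}h_{ij}K_{S,i}^\dagger K_{S,j}$. The notation $x\gtrsim y$ means $x\ge \ell(y)$ for some function $\ell(y)=y+O(y^2)$. *)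

(* Defs.v *)
From HB Require Import structures.
From mathcomp Require Import all_boot all_order all_algebra.
From mathcomp Require Import complex mxtens.
From mathcomp Require Import boolp classical_sets reals topology normedtype.
Set Implicit Arguments. Unset Strict Implicit. Unset Printing Implicit Defensive.
Import Order.TTheory GRing.Theory Num.Theory numFieldNormedType.Exports.
Local Open Scope ring_scope.
Local Open Scope classical_set_scope.

Section QDefs.
Variable R : realType.
Local Notation C := (R[i]).

Definition mxadj m n (A : 'M[C]_(m, n)) : 'M[C]_(n, m) := (map_mx (@conjc R) A)^T.

Definition herm_mx n (A : 'M[C]_n) : Prop := mxadj A = A.

Definition psd n (A : 'M[C]_n) : Prop :=
  herm_mx A /\ forall v : 'cV[C]_n, 0 <= complex.Re ((mxadj v *m A *m v) 0 0).

Definition density n (rho : 'M[C]_n) : Prop := psd rho /\ \tr rho = 1.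

Definition sqrtm n (A : 'M[C]_n) : 'M[C]_n :=
  xget 0 [set X | psd X /\ X *m X = A].

Definition fidelity n (rho sigma : 'M[C]_n) : R :=
  complex.Re (\tr (sqrtm (sqrtm rho *m sigma *m sqrtm rho))).

Definition pdist n (rho sigma : 'M[C]_n) : R := Num.sqrt (1 - fidelity rho sigma ^+ 2).

(* Channels from an m-dimensional to an n-dimensional system are given by
   a finite list of Kraus operators. *)
Definition kraus_tp m n (Ks : seq 'M[C]_(n, m)) : Prop :=
  \sum_(K <- Ks) mxadj K *m K = 1%:M.

Definition apply_ext m n (Ks : seq 'M[C]_(n, m)) r (rho : 'M[C]_(m * r)) : 'M[C]_(n * r) :=
  \sum_(K <- Ks) (K *t (1%:M : 'M[C]_r)) *m rho *m mxadj (K *t (1%:M : 'M[C]_r)).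

Definition kraus_comp m n p (Ks2 : seq 'M[C]_(p, n)) (Ks1 : seq 'M[C]_(n, m))
  : seq 'M[C]_(p, m) := [seq A *m B | A <- Ks2, B <- Ks1].

Definition chan_pdist m n (Ks1 Ks2 : seq 'M[C]_(n, m)) : R :=
  sup [set x | exists (r : nat) (rho : 'M[C]_(m * r)),
         density rho /\ x = pdist (apply_ext Ks1 rho) (apply_ext Ks2 rho)].

Definition mxpow n (A : 'M[C]_n) (k : nat) : 'M[C]_n := iter k (mulmx A) 1%:M.

Definition exp_partial n (A : 'M[C]_n) (N : nat) : 'M[C]_n :=
  \sum_(k < N) (k`!%:R)^-1 *: mxpow A k.

Definition expm n (A : 'M[C]_n) : 'M[C]_n :=
  \matrix_(i, j) Complex (limn (fun N => complex.Re (exp_partial A N i j)))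
                         (limn (fun N => complex.Im (exp_partial A N i j))).

Definition Uop n (H : 'M[C]_n) (theta : R) : 'M[C]_n :=
  expm (Complex 0 (- theta) *: H).

(* Delta X = largest eigenvalue minus smallest eigenvalue (X Hermitian) *)
Definition spec_re n (X : 'M[C]_n) : set R :=
  [set complex.Re a | a in [set a | eigenvalue X a]].
Definition Delta n (X : 'M[C]_n) : R := sup (spec_re X) - inf (spec_re X).

Definition nontrivial n (H : 'M[C]_n) : Prop := ~ exists c : C, H = c%:M.

Definition kraus_seq n k (K : 'I_k -> 'M[C]_n) : seq 'M[C]_n := [seq K i | i <- enum 'I_k].

Definition in_kraus_span n k (K : 'I_k -> 'M[C]_n) (H : 'M[C]_n) : Prop :=
  exists c : 'I_k -> 'I_k -> C, H = \sum_i \sum_j c i j *: (mxadj (K i) *m K j).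

Definition qec_eps dL dS k (V : 'M[C]_(dS, dL)) (K : 'I_k -> 'M[C]_dS) : R :=
  inf [set x | exists Rk : seq 'M[C]_(dL, dS), kraus_tp Rk /\
         x = chan_pdist (kraus_comp Rk (kraus_comp (kraus_seq K) [:: V]))
                        [:: (1%:M : 'M[C]_dL)]].

Definition deltaG dL dS (HL : 'M[C]_dL) (HS : 'M[C]_dS) (V : 'M[C]_(dS, dL)) : R :=
  sup [set x | exists theta : R,
         x = chan_pdist [:: Uop HS theta *m V] [:: V *m Uop HL theta]].

Definition frakJ n k (K : 'I_k -> 'M[C]_n) (H : 'M[C]_n) : R :=
  inf [set x | exists h : 'M[C]_k, herm_mx h /\
         H = \sum_i \sum_j h i j *: (mxadj (K i) *m K j) /\ x = Delta h].

End QDefs.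

(* Main.v *)
(* Let |0>, |1> be eigenvectors of H_L for its largest and smallest eigenvalues E_0, E_1,
   and probe all channels with (|00> + |11>)/sqrt 2, the second factor being a
   reference qubit.

   Covariance. The overlap of the two evolved encoded probes is the quasiperiodic
   function g(t) = 1/2 sum_b sum_n p_b(n) exp(i (E_b - d_n) t), where p_b is the
   distribution of the energy d_n of H_S in V|b>.  Since |g(t)|^2 >= 1 - delta^2 for all
   t, averaging over t shows that a single frequency carries weight 1 - eta with
   2 eta (1 - eta) <= delta^2.  Hence, up to weight eta_b with eta_0 + eta_1 = 2 eta, V|b>
   has the sharp energy E_b - mu, and Delta H_L differs from
   chi = <0|V^* H_S V|0> - <1|V^* H_S V|1> by at most 2 eta Delta H_S.

   Recovery. After diagonalising h, chi is a difference of expectations of h in the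
   environment of the noise followed by the recovery.  Fidelity with the probe forces both
   environment states to be close to a common one, whence chi <= 2 epsilon Delta h.

   Altogether y^2 <= 2 eta for the right-hand side y, so delta >= y - y^2. *)
Require Import Defs.
From HB Require Import structures.
From mathcomp Require Import all_boot all_order all_algebra.
From mathcomp Require Import complex mxtens.
From mathcomp Require Import boolp classical_sets reals topology normedtype.
From mathcomp Require Import spectral sesquilinear sequences trigo.
From mathcomp Require Import ring lra.
Set Implicit Arguments. Unset Strict Implicit. Unset Printing Implicit Defensive.
Import Order.TTheory GRing.Theory Num.Theory numFieldNormedType.Exports.
Local Open Scope classical_set_scope.
Local Open Scope ring_scope.
Local Open Scope complex_scope.

(** * Adjoints and the spectral theorem *)

Section Adjoint.
Variable R : realType.
Local Notation C := (R[i]).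

Lemma ReD (z w : C) : complex.Re (z + w) = complex.Re z + complex.Re w.
Proof. by case: z w => [? ?] []. Qed.

Lemma ReZ (a : R) (z : C) : complex.Re (a%:C * z) = a * complex.Re z.
Proof. by case: z => x y /=; rewrite mul0r subr0. Qed.

Lemma ImZ (a : R) (z : C) : complex.Im (a%:C * z) = a * complex.Im z.
Proof. by case: z => x y /=; rewrite mul0r addr0. Qed.

Lemma Re_sum (I : Type) (r : seq I) (P : pred I) (F : I -> C) :
  complex.Re (\sum_(i <- r | P i) F i) = \sum_(i <- r | P i) complex.Re (F i).
Proof. by apply: (big_morph (@complex.Re R)) => // -[? ?] [? ?]. Qed.

Lemma Im_sum (I : Type) (r : seq I) (P : pred I) (F : I -> C) :
  complex.Im (\sum_(i <- r | P i) F i) = \sum_(i <- r | P i) complex.Im (F i).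
Proof. by apply: (big_morph (@complex.Im R)) => // -[? ?] [? ?]. Qed.

Lemma conjcM (z w : C) : conjc (z * w) = conjc z * conjc w.
Proof. exact: rmorphM. Qed.

Lemma mxadj_conjC m n (A : 'M[C]_(m, n)) : mxadj A = map_mx Num.conj A^T.
Proof. by rewrite /mxadj map_trmx. Qed.

Lemma mxadjE m n (A : 'M[C]_(m, n)) i j : mxadj A i j = conjc (A j i).
Proof. by rewrite !mxE. Qed.

Lemma mxadjK m n (A : 'M[C]_(m, n)) : mxadj (mxadj A) = A.
Proof. by apply/matrixP=> i j; rewrite !mxE conjcK. Qed.

Lemma mxadjM m n p (A : 'M[C]_(m, n)) (B : 'M[C]_(n, p)) :
  mxadj (A *m B) = mxadj B *m mxadj A.
Proof. by rewrite /mxadj map_mxM trmx_mul. Qed.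

Lemma mxadj_tens m n p q (A : 'M[C]_(m, n)) (B : 'M[C]_(p, q)) :
  mxadj (A *t B) = mxadj A *t mxadj B.
Proof. by rewrite /mxadj map_mxT trmx_tens. Qed.

Lemma mxadjD m n (A B : 'M[C]_(m, n)) : mxadj (A + B) = mxadj A + mxadj B.
Proof. by rewrite /mxadj map_mxD linearD. Qed.

Lemma mxadj_sum m n I (r : seq I) (P : pred I) (F : I -> 'M[C]_(m, n)) :
  mxadj (\sum_(i <- r | P i) F i) = \sum_(i <- r | P i) mxadj (F i).
Proof. by rewrite /mxadj raddf_sum raddf_sum. Qed.

Lemma mxadjZ m n a (A : 'M[C]_(m, n)) : mxadj (a *: A) = conjc a *: mxadj A.
Proof. by rewrite /mxadj map_mxZ linearZ. Qed.

Lemma mxadj1 n : mxadj 1%:M = 1%:M :> 'M[C]_n.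
Proof. by rewrite /mxadj map_mx1 trmx1. Qed.

(** The spectral theorem with the eigenvalues recorded as real numbers; this is the form in which
    [Uop], [Delta] and positive square roots are later computed. *)
Lemma herm_spectral n (H : 'M[C]_n) : herm_mx H ->
  exists (Q : 'M[C]_n) (d : 'I_n -> R),
    [/\ mxadj Q *m Q = 1%:M, Q *m mxadj Q = 1%:M
      & H = mxadj Q *m diag_mx (\row_i (d i)%:C) *m Q].
Proof.
move=> hH.
have hs : H \is hermsymmx.
  by rewrite qualifE /= expr0 scale1r; apply/eqP; rewrite -map_trmx -[LHS]hH.
have Hn := hermitian_normalmx hs.
have /orthomx_spectralP /= e := Hn.
have Qu := spectral_unitarymx H.
exists (spectralmx H), (fun i => complex.Re (spectral_diag H 0 i)).
have /unitarymxP Q1 := Qu.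
rewrite mxadj_conjC -(invmx_unitary Qu); split.
- by rewrite mulVmx // spectral_unit.
- by rewrite mulmxV // spectral_unit.
- rewrite [LHS]e; congr (_ *m diag_mx _ *m _).
  apply/rowP => i; rewrite mxE RRe_real //.
  by have /mxOverP := hermitian_spectral_diag_real hs; apply.
Qed.
End Adjoint.

(** * Square roots and fidelity with a pure state *)

Section Fidelity.
Variable R : realType.
Local Notation C := (R[i]).

Lemma tr_gram m n (B : 'M[C]_(m, n)) :
  \tr (mxadj B *m B) = \sum_j \sum_i conjc (B i j) * B i j.
Proof.
apply: eq_bigr => j _; rewrite mxE; apply: eq_bigr => i _.
by rewrite mxadjE.
Qed.

Lemma conjcM_ge0 (z : C) : 0 <= conjc z * z.
Proof. by rewrite mulrC mulcJ_ge0. Qed.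

Lemma tr_gram_ge0 m n (B : 'M[C]_(m, n)) : 0 <= \tr (mxadj B *m B).
Proof. by rewrite tr_gram; do 2!apply: sumr_ge0 => ? _; apply: conjcM_ge0. Qed.

Lemma tr_gram_eq0 m n (B : 'M[C]_(m, n)) : \tr (mxadj B *m B) = 0 -> B = 0.
Proof.
rewrite tr_gram => /eqP; rewrite psumr_eq0; last first.
  by move=> j _; apply: sumr_ge0 => i _; apply: conjcM_ge0.
move=> /allP h; apply/matrixP => i j; rewrite mxE.
have /implyP/(_ isT) := h j (mem_index_enum j).
rewrite psumr_eq0; last by move=> ? _; apply: conjcM_ge0.
move=> /allP /(_ i (mem_index_enum i)) /implyP/(_ isT).
by rewrite mulf_eq0 conjc_eq0 orbb => /eqP.
Qed.

Lemma psd_gram m n (B : 'M[C]_(m, n)) : psd (mxadj B *m B).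
Proof.
split; first by rewrite /herm_mx mxadjM mxadjK.
move=> v; rewrite -mulmxA -mulmxA mulmxA -mxadjM.
have := tr_gram_ge0 (B *m v); rewrite /mxtrace big_ord1.
by rewrite lecE => /andP[].
Qed.

Lemma mxadj_diag_real n (d : 'I_n -> R) :
  mxadj (diag_mx (\row_i (d i)%:C)) = diag_mx (\row_i (d i)%:C).
Proof.
apply/matrixP => i j; rewrite mxadjE !mxE eq_sym.
by case: eqP => [->|_]; rewrite ?mulr1n ?mulr0n ?conjc_real ?conjc0.
Qed.

Lemma diag_mx_sqrt n (d : 'I_n -> R) : (forall i, 0 <= d i) ->
  diag_mx (\row_i (d i)%:C) =
  diag_mx (\row_i (Num.sqrt (d i))%:C) *m diag_mx (\row_i (Num.sqrt (d i))%:C).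
Proof.
move=> d0; rewrite mulmx_diag; congr diag_mx.
by apply/rowP => i; rewrite !mxE -rmorphM /= -expr2 sqr_sqrtr.
Qed.

Lemma psd_spectral n (A : 'M[C]_n) : psd A ->
  exists (Q : 'M[C]_n) (d : 'I_n -> R),
    [/\ mxadj Q *m Q = 1%:M, Q *m mxadj Q = 1%:M,
        A = mxadj Q *m diag_mx (\row_i (d i)%:C) *m Q
      & forall i, 0 <= d i].
Proof.
move=> [/herm_spectral [Q [d [Q1 Q2 e]]] pA]; exists Q, d; split=> // i.
(* Testing against the i-th eigenvector evaluates the quadratic form to [d i]. *)
have := pA (mxadj Q *m delta_mx i 0); rewrite mxadjM mxadjK e !mulmxA.
rewrite -[mxadj _ *m Q *m _]mulmxA Q2 mulmx1 -[_ *m Q *m _]mulmxA Q2 mulmx1.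
suff -> : mxadj (delta_mx i 0) = delta_mx 0 i :> 'M[C]_(1, n).
  by rewrite -rowE -colE !mxE eqxx mulr1n.
by apply/matrixP=> a b; rewrite !mxE rmorph_nat andbC.
Qed.

Lemma psd_factor n (A : 'M[C]_n) : psd A -> exists B : 'M[C]_n, A = mxadj B *m B.
Proof.
move=> /psd_spectral [Q [d [_ _ -> d0]]].
exists (diag_mx (\row_i (Num.sqrt (d i))%:C) *m Q).
by rewrite mxadjM mxadj_diag_real (diag_mx_sqrt d0) !mulmxA.
Qed.

Lemma psd_sqrt_exists n (A : 'M[C]_n) : psd A ->
  exists X : 'M[C]_n, psd X /\ X *m X = A.
Proof.
move=> /psd_spectral [Q [d [Q1 Q2 -> d0]]].
exists (mxadj Q *m diag_mx (\row_i (Num.sqrt (d i))%:C) *m Q); split.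
  rewrite (@diag_mx_sqrt _ (fun i => Num.sqrt (d i))); last by move=> i; apply: sqrtr_ge0.
  rewrite -{1}mxadj_diag_real -!mulmxA mulmxA -mxadjM; apply: psd_gram.
by rewrite !mulmxA -[_ *m Q *m _]mulmxA Q2 mulmx1 (diag_mx_sqrt d0) !mulmxA.
Qed.

(* With D = X - Y and X^2 = Y^2, tr(D X D) + tr(D Y D) = 0 although both terms
   are nonnegative. *)
Lemma psd_sqrt_unique n (X Y : 'M[C]_n) :
  psd X -> psd Y -> X *m X = Y *m Y -> X = Y.
Proof.
move=> pX pY e; have [hX _] := pX; have [hY _] := pY.
have [B1 e1] := psd_factor pX; have [B2 e2] := psd_factor pY.
pose D := X - Y.
have hD : mxadj D = D.
  by rewrite /D mxadjD -scaleN1r mxadjZ hX hY rmorphN rmorph1 scaleN1r.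
have key : \tr (D *m X *m D) + \tr (D *m Y *m D) = 0.
  rewrite -linearD /= -mulmxDl -mulmxDr /D.
  have -> : (X - Y) *m (X + Y) = X *m Y - Y *m X.
    by rewrite mulmxBl !mulmxDr [X *m X + _]addrC [Y *m X + _]addrC e addrKA.
  have trB (A B : 'M[C]_n) : \tr (A - B) = \tr A - \tr B by exact: raddfB.
  rewrite mulmxBl !mulmxBr !trB.
  rewrite [\tr (X *m Y *m X)]mxtrace_mulC [\tr (Y *m X *m Y)]mxtrace_mulC !mulmxA e.
  have -> : \tr (X *m Y *m Y) = \tr (Y *m Y *m X) by rewrite -mulmxA mxtrace_mulC.
  have -> : Y *m X *m X = Y *m Y *m Y by rewrite -mulmxA e mulmxA.
  ring.
move: key; rewrite {1}e1 e2 => /eqP.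
have f B : D *m (mxadj B *m B) *m D = mxadj (B *m D) *m (B *m D).
  by rewrite mxadjM hD !mulmxA.
rewrite !f paddr_eq0 ?tr_gram_ge0 // => /andP[/eqP/tr_gram_eq0 z1 /eqP/tr_gram_eq0 z2].
have DD : mxadj D *m D = 0.
  by rewrite hD {1}/D mulmxBl {1}e1 {1}e2 -!mulmxA z1 z2 !mulmx0 subrr.
have : D = 0 by apply: tr_gram_eq0; rewrite DD mxtrace0.
rewrite -e2; move/eqP; by rewrite subr_eq0 => /eqP.
Qed.

(** [sqrtm] is an arbitrary choice among the positive roots, so uniqueness is what identifies it
    with an explicit one. *)
Lemma sqrtm_eq n (A X : 'M[C]_n) : psd X -> X *m X = A -> sqrtm A = X.
Proof.
move=> pX e; rewrite /sqrtm; case: xgetP => [Y _ [pY eY]|].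
  by apply: psd_sqrt_unique => //; rewrite eY.
by move=> /(_ X) /=; case.
Qed.

Lemma sqrtmP n (A : 'M[C]_n) : psd A -> psd (sqrtm A) /\ sqrtm A *m sqrtm A = A.
Proof.
by move=> /psd_sqrt_exists [X [pX e]]; rewrite (sqrtm_eq pX e).
Qed.

Lemma psdZ n (a : R) (A : 'M[C]_n) : 0 <= a -> psd A -> psd (a%:C *: A).
Proof.
move=> a0 [hA pA]; split; first by rewrite /herm_mx mxadjZ hA conjc_real.
move=> v; rewrite -scalemxAr -scalemxAl mxE.
by move: (pA v); case: (X in complex.Re (_ * X)) => x y /=; rewrite mul0r subr0 => ?; apply: mulr_ge0.
Qed.

Lemma psd_rank1 n (phi : 'cV[C]_n) : psd (phi *m mxadj phi).
Proof. by have := psd_gram (mxadj phi); rewrite mxadjK. Qed.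

Lemma gram_real n (phi : 'cV[C]_n) :
  mxadj phi *m phi = (complex.Re ((mxadj phi *m phi) 0 0))%:C%:M.
Proof.
rewrite [LHS]mx11_scalar; congr (_%:M).
by have := tr_gram_ge0 phi; rewrite /mxtrace big_ord1; case: (X in 0 <= X) => x y; rewrite lecE /= => /andP[/eqP ->].
Qed.

(** The rank-one operator P of a vector of norm r satisfies P^2 = r^2 P, so P / r squares to P. *)
Lemma sqrtm_rank1 n (phi : 'cV[C]_n) (r : R) : 0 < r ->
  complex.Re ((mxadj phi *m phi) 0 0) = r ^+ 2 ->
  sqrtm (phi *m mxadj phi) = (r^-1)%:C *: (phi *m mxadj phi).
Proof.
move=> r0 e; apply: sqrtm_eq.
  by apply: psdZ; rewrite ?invr_ge0 ?ltW //; apply: psd_rank1.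
rewrite -scalemxAl -scalemxAr !mulmxA -[phi *m _ *m phi]mulmxA gram_real e.
rewrite mul_mx_scalar -!scalemxAl !scalerA -!rmorphM /=.
rewrite -[RHS]scale1r; congr (_ *: _).
rewrite -[RHS](rmorph1 (real_complex R)); apply: (congr1 (real_complex R)).
by field; rewrite gt_eqF.
Qed.

(** With S the root of [rho], the operator under the outer root is the rank-one operator of S phi.
    The trace of its root is the norm of S phi, whose square is <phi, rho phi>. *)
Lemma fidelity_pure n (rho : 'M[C]_n) (phi : 'cV[C]_n) : psd rho ->
  fidelity rho (phi *m mxadj phi) =
  Num.sqrt (complex.Re ((mxadj phi *m rho *m phi) 0 0)).
Proof.
move=> prho; rewrite /fidelity; have [pS eS] := sqrtmP prho.
have [hS _] := pS; set S := sqrtm rho in pS eS hS *.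
have -> : S *m (phi *m mxadj phi) *m S = (S *m phi) *m mxadj (S *m phi).
  by rewrite mxadjM hS !mulmxA.
have -> : mxadj phi *m rho *m phi = mxadj (S *m phi) *m (S *m phi).
  by rewrite mxadjM hS -eS !mulmxA.
move: (S *m phi) => {S pS eS hS prho rho} {}phi.
set x := complex.Re ((mxadj phi *m phi) 0 0).
have x0 : 0 <= x.
  by have := tr_gram_ge0 phi; rewrite gram_real -/x mxtrace_scalar ler0c.
have tr : \tr (phi *m mxadj phi) = x%:C.
  by rewrite mxtrace_mulC gram_real mxtrace_scalar.
(* The zero vector is treated apart because the rank-one formula divides by the norm. *)
have [z|nz] := eqVneq x 0.
  rewrite z sqrtr0.
  have -> : phi = 0.
    by apply: tr_gram_eq0; rewrite gram_real -/x z mxtrace_scalar.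
  have p0 : psd (0 : 'M[C]_n).
    by have := psd_rank1 (0 : 'cV[C]_n); rewrite mul0mx.
  by rewrite mul0mx (sqrtm_eq p0) ?mul0mx ?mxtrace0.
have r0 : 0 < Num.sqrt x by rewrite sqrtr_gt0 lt_def nz.
rewrite (sqrtm_rank1 r0) ?sqr_sqrtr // mxtraceZ tr -rmorphM /=.
by rewrite -[X in _ * X](sqr_sqrtr x0) expr2 mulKf // gt_eqF.
Qed.

Lemma pdist_le1 n (rho sigma : 'M[C]_n) : pdist rho sigma <= 1.
Proof.
rewrite -[leRHS]sqrtr1 ler_wsqrtr // lerBlDl lerDr; exact: sqr_ge0.
Qed.
End Fidelity.

(** * Unitary evolution and spectral range *)

Section Evolution.
Variable R : realType.
Local Notation C := (R[i]).

Lemma mxpow_spectral n (Q : 'M[C]_n) (e : 'rV[C]_n) k :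
  mxadj Q *m Q = 1%:M -> Q *m mxadj Q = 1%:M ->
  mxpow (mxadj Q *m diag_mx e *m Q) k =
  mxadj Q *m diag_mx (\row_i (e 0 i ^+ k)) *m Q.
Proof.
move=> Q1 Q2; rewrite /mxpow; elim: k => [|k IH] /=.
  suff -> : diag_mx (\row_i (e 0 i ^+ 0)) = 1%:M by rewrite mulmx1 Q1.
  by apply/matrixP => i j; rewrite !mxE expr0.
rewrite IH !mulmxA -[_ *m Q *m mxadj Q]mulmxA Q2 mulmx1 -[_ *m _ *m diag_mx _]mulmxA mulmx_diag.
by do 2!congr (_ *m _); congr diag_mx; apply/rowP => i; rewrite !mxE exprS.
Qed.

(* exp(- i x) *)
Definition expi (x : R) : C := Complex (cos x) (- sin x).

Lemma pow_imag (x : R) k :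
  (k`!%:R)^-1 * Complex 0 (- x) ^+ k = Complex (cos_coeff x k) (- sin_coeff x k).
Proof.
(* Even powers of - i x are real; the odd case takes one more factor. *)
have aux : forall m, Complex 0 (- x) ^+ (m.*2) = Complex ((-1) ^+ m * x ^+ m.*2) 0 :> C.
  elim=> [|m IH]; first by rewrite !expr0 mul1r.
  rewrite doubleS !exprS IH; apply/eqP; rewrite eq_complex /=; apply/andP; split; apply/eqP; ring.
have fk : (k`!%:R : C)^-1 = (k`!%:R^-1)%:C by rewrite fmorphV rmorph_nat.
rewrite fk cos_coeffE sin_coeffE /= -(odd_double_half k).
case: (odd k); rewrite ?add0n ?add1n ?exprS aux /= odd_double /= ?doubleK ?uphalf_double.
  apply/eqP; rewrite eq_complex /=; apply/andP; split; apply/eqP; ring.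
apply/eqP; rewrite eq_complex /=; apply/andP; split; apply/eqP; ring.
Qed.

Lemma spectral_entryE n (Q : 'M[C]_n) (e : 'rV[C]_n) i j :
  (mxadj Q *m diag_mx e *m Q) i j = \sum_l conjc (Q l i) * Q l j * e 0 l.
Proof.
rewrite mxE; apply: eq_bigr => l _; rewrite mul_mx_diag !mxE.
by rewrite -!mulrA; congr (_ * _); rewrite mulrC.
Qed.


Lemma cvgn_sum (I : Type) (r : seq I) (F : I -> nat -> R) (l : I -> R) :
  (forall i, F i @ \oo --> l i) ->
  (fun N => \sum_(i <- r) F i N) @ \oo --> \sum_(i <- r) l i.
Proof.
move=> h; elim: r => [|i r IH].
  by rewrite big_nil; under eq_fun do rewrite big_nil; exact: cvg_cst.
by rewrite big_cons; under eq_fun do rewrite big_cons; apply: cvgD.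
Qed.

Lemma exp_partial_spectral n (Q : 'M[C]_n) (d : 'I_n -> R) (t : R) N i j :
  mxadj Q *m Q = 1%:M -> Q *m mxadj Q = 1%:M ->
  exp_partial (Complex 0 (- t) *: (mxadj Q *m diag_mx (\row_l (d l)%:C) *m Q)) N i j =
  \sum_l conjc (Q l i) * Q l j *
    Complex (series (cos_coeff (t * d l)) N) (- series (sin_coeff (t * d l)) N).
Proof.
move=> Q1 Q2.
have -> : Complex 0 (- t) *: (mxadj Q *m diag_mx (\row_l (d l)%:C) *m Q) =
  mxadj Q *m diag_mx (\row_l (Complex 0 (- (t * d l)))) *m Q.
  rewrite scalemxAl scalemxAr -linearZ /=; do 2!congr (_ *m _); congr diag_mx.
  apply/rowP => l; rewrite !mxE; apply/eqP; rewrite eq_complex /=.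
  by apply/andP; split; apply/eqP; ring.
rewrite /exp_partial summxE.
under eq_bigr => k _ do rewrite mxE mxpow_spectral // spectral_entryE mulr_sumr.
rewrite exchange_big /=; apply: eq_bigr => l _.
have -> : Complex (series (cos_coeff (t * d l)) N) (- series (sin_coeff (t * d l)) N) =
  \sum_(k < N) Complex (cos_coeff (t * d l) k) (- sin_coeff (t * d l) k).
  rewrite !seriesEord /=; elim: N => [|N IH].
    by rewrite !big_ord0 oppr0.
  rewrite !big_ord_recr /= -IH; apply/eqP; rewrite eq_complex /= opprD.
  by rewrite !eqxx.
rewrite mulr_sumr; apply: eq_bigr => k _.
by rewrite mulrCA -pow_imag !mxE.
Qed.

(** [expm] takes entrywise limits of real and imaginary parts. In the eigenbasis each of these is a
    finite combination of partial sums of the cosine and sine series, whose limits are known. *)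
Lemma Uop_spectral n (Q : 'M[C]_n) (d : 'I_n -> R) (t : R) :
  mxadj Q *m Q = 1%:M -> Q *m mxadj Q = 1%:M ->
  Uop (mxadj Q *m diag_mx (\row_l (d l)%:C) *m Q) t =
  mxadj Q *m diag_mx (\row_l expi (t * d l)) *m Q.
Proof.
move=> Q1 Q2; apply/matrixP => i j; rewrite spectral_entryE mxE.
pose c l := conjc (Q l i) * Q l j.
have -> : (fun N => complex.Re (exp_partial (Complex 0 (- t) *: (mxadj Q *m diag_mx (\row_l (d l)%:C) *m Q)) N i j)) =
  (fun N => \sum_l (complex.Re (c l) * series (cos_coeff (t * d l)) N
     + complex.Im (c l) * series (sin_coeff (t * d l)) N)).
  apply/funext => N; rewrite exp_partial_spectral //.
  rewrite (big_morph (@complex.Re R) (id1 := 0) (op1 := +%R)) //; last by case=> ? ? [].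
  by apply: eq_bigr => l _; rewrite -/(c l); case: (c l) => a b /=; ring.
have -> : (fun N => complex.Im (exp_partial (Complex 0 (- t) *: (mxadj Q *m diag_mx (\row_l (d l)%:C) *m Q)) N i j)) =
  (fun N => \sum_l (complex.Im (c l) * series (cos_coeff (t * d l)) N
     - complex.Re (c l) * series (sin_coeff (t * d l)) N)).
  apply/funext => N; rewrite exp_partial_spectral //.
  rewrite (big_morph (@complex.Im R) (id1 := 0) (op1 := +%R)) //; last by case=> ? ? [].
  by apply: eq_bigr => l _; rewrite -/(c l); case: (c l) => a b /=; ring.
have cc x : series (@cos_coeff R x) @ \oo --> cos x.
  by rewrite unlock; exact: is_cvg_series_cos_coeff.
have cs x : series (@sin_coeff R x) @ \oo --> sin x.
  by rewrite unlock; exact: is_cvg_series_sin_coeff.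
rewrite (_ : limn _ = \sum_l (complex.Re (c l) * cos (t * d l)
     + complex.Im (c l) * sin (t * d l))); last first.
  apply/cvg_lim => //; apply: cvgn_sum => l.
  by apply: cvgD; [exact: (cvgMl_tmp (cc _)) | exact: (cvgMl_tmp (cs _))].
rewrite (_ : limn _ = \sum_l (complex.Im (c l) * cos (t * d l)
     - complex.Re (c l) * sin (t * d l))); last first.
  apply/cvg_lim => //; apply: cvgn_sum => l.
  by apply: cvgB; [exact: (cvgMl_tmp (cc _)) | exact: (cvgMl_tmp (cs _))].
apply/eqP; rewrite eq_complex /=; apply/andP; split; apply/eqP.
  rewrite (big_morph (@complex.Re R) (id1 := 0) (op1 := +%R)) //; last by case=> ? ? [].
  by apply: eq_bigr => l _; rewrite mxE -/(c l); case: (c l) => a b /=; ring.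
rewrite (big_morph (@complex.Im R) (id1 := 0) (op1 := +%R)) //; last by case=> ? ? [].
by apply: eq_bigr => l _; rewrite mxE -/(c l); case: (c l) => a b /=; ring.
Qed.

Lemma spec_re_spectral n (Q : 'M[C]_n) (d : 'I_n -> R) :
  mxadj Q *m Q = 1%:M -> Q *m mxadj Q = 1%:M ->
  spec_re (mxadj Q *m diag_mx (\row_l (d l)%:C) *m Q) = range d.
Proof.
move=> Q1 Q2; apply/seteqP; split=> x /=.
  move=> [a /eigenvalueP [v ev v0] <-].
  (* Eigenvectors are rows here: [w] is a row eigenvector of the diagonal matrix, and a nonzero
     coordinate i of it forces a = d i. *)
  pose w := v *m mxadj Q.
  have ew : w *m diag_mx (\row_l (d l)%:C) = a *: w.
    move: ev => /(congr1 (mulmx^~ (mxadj Q))); rewrite !mulmxA -[_ *m Q *m mxadj Q]mulmxA Q2 mulmx1.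
    by rewrite -scalemxAl.
  have : w != 0.
    apply: contra v0 => /eqP w0; rewrite -[v]mulmx1 -Q1 mulmxA -/w w0 mul0mx //.
  move=> /rV0Pn [i wi]; exists i => //.
  have := congr1 (fun M : 'rV[C]_n => M 0 i) ew.
  by rewrite /= mul_mx_diag mxE [(a *: w) 0 i]mxE [(\row__ _) 0 i]mxE mulrC => /(mulIf wi) <-.
move=> [i _ <-]; exists (d i)%:C => //.
apply/eigenvalueP; exists (row i Q).
  rewrite -!row_mul !mulmxA Q2 mul1mx; apply/rowP => j.
  by rewrite !mxE (bigD1 i) //= !mxE eqxx mulr1n big1 ?addr0 // => k ki; rewrite !mxE eq_sym (negPf ki) mulr0n mul0r.
apply/negP => /eqP r0.
have := congr1 (row i) Q2; rewrite row_mul r0 mul0mx row1 => /matrixP /(_ 0 i).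
by rewrite !mxE !eqxx => /eqP; rewrite eq_sym oner_eq0.
Qed.

Lemma Delta_spectral n (Q : 'M[C]_n) (d : 'I_n -> R) : (0 < n)%N ->
  mxadj Q *m Q = 1%:M -> Q *m mxadj Q = 1%:M ->
  exists i0 i1, (forall i, d i1 <= d i <= d i0) /\
    Delta (mxadj Q *m diag_mx (\row_l (d l)%:C) *m Q) = d i0 - d i1.
Proof.
case: n Q d => // n Q d _ Q1 Q2.
pose i0 := [arg max_(i > (ord0 : 'I_n.+1)) d i]%O.
pose i1 := [arg min_(i < (ord0 : 'I_n.+1)) d i]%O.
have h0 i : d i <= d i0 by rewrite /i0; case: arg_maxP => // j _; apply.
have h1 i : d i1 <= d i by rewrite /i1; case: arg_minP => // j _; apply.
exists i0, i1; split; first by move=> i; rewrite h0 h1.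
rewrite /Delta spec_re_spectral //; congr (_ - _); apply/eqP; rewrite eq_le.
  apply/andP; split.
    by apply: ge_sup; [exists (d i0), i0 | move=> _ [i _ <-]].
  by apply: ub_le_sup; [exists (d i0) => _ [i _ <-] | exists i0].
apply/andP; split.
  by apply: ge_inf; [exists (d i1) => _ [i _ <-] | exists i1].
by apply: lb_le_inf; [exists (d i1), i1 | move=> _ [i _ <-]].
Qed.

End Evolution.

(** * Recovery and the energy of the code states *)

Section ExpectationGap.
Variable R : realType.
Local Notation C := (R[i]).

(** Lagrange's identity: the sum over all pairs of (a_t b_s - a_s b_t)^2 is twice the difference of
    the two sides. *)
Lemma sum_CauchySchwarz (T : finType) (a b : T -> R) :
  (\sum_t a t * b t) ^+ 2 <= (\sum_t a t ^+ 2) * (\sum_t b t ^+ 2).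
Proof.
have : 0 <= \sum_t \sum_s (a t * b s - a s * b t) ^+ 2.
  by do 2!apply: sumr_ge0 => ? _; apply: sqr_ge0.
suff -> : \sum_t \sum_s (a t * b s - a s * b t) ^+ 2 =
  ((\sum_t a t ^+ 2) * (\sum_t b t ^+ 2) - (\sum_t a t * b t) ^+ 2) *+ 2.
  by rewrite pmulrn_lge0 // subr_ge0.
have -> : \sum_t \sum_s (a t * b s - a s * b t) ^+ 2 =
  \sum_t \sum_s (a t ^+ 2 * b s ^+ 2) + \sum_t \sum_s (a s ^+ 2 * b t ^+ 2)
   - (\sum_t \sum_s (a t * b t) * (a s * b s)) *+ 2.
  rewrite -sumrMnl -sumrN -!big_split /=; apply: eq_bigr => t _.
  rewrite -sumrMnl -sumrN -!big_split /=; apply: eq_bigr => s _.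
  ring.
rewrite [X in _ + X - _]exchange_big /= expr2 !big_distrlr /=; ring.
Qed.

(* Centre d at (lo + hi) / 2, factor x^2 - y^2 = (x - y)(x + y), and apply
   Cauchy-Schwarz with |x - y|^2 |x + y|^2 = (2 - 2 s)(2 + 2 s). *)
Lemma expectation_gap_real (T : finType) (d x y : T -> R) (lo hi : R) :
  (forall t, lo <= d t <= hi) -> lo <= hi ->
  \sum_t x t ^+ 2 = 1 -> \sum_t y t ^+ 2 = 1 ->
  (\sum_t x t * y t) ^+ 2 <= 1 /\
  `|\sum_t d t * x t ^+ 2 - \sum_t d t * y t ^+ 2|
   <= (hi - lo) * Num.sqrt (1 - (\sum_t x t * y t) ^+ 2).
Proof.
move=> dlh lh nx ny; split.
  by have := sum_CauchySchwarz x y; rewrite nx ny mulr1.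
set s := \sum_t x t * y t.
have eD : \sum_t `|x t - y t| ^+ 2 = 2 - 2 * s.
  transitivity (\sum_t x t ^+ 2 + \sum_t y t ^+ 2 - 2 * s); last by rewrite nx ny.
  rewrite /s mulr_sumr -sumrN -!big_split /=; apply: eq_bigr => t _.
  by rewrite real_normK ?num_real //; ring.
have eS : \sum_t `|x t + y t| ^+ 2 = 2 + 2 * s.
  transitivity (\sum_t x t ^+ 2 + \sum_t y t ^+ 2 + 2 * s); last by rewrite nx ny.
  rewrite /s mulr_sumr -!big_split /=; apply: eq_bigr => t _.
  by rewrite real_normK ?num_real //; ring.
have cs : \sum_t `|x t - y t| * `|x t + y t| <= 2 * Num.sqrt (1 - s ^+ 2).
  have := sum_CauchySchwarz (fun t => `|x t - y t|) (fun t => `|x t + y t|).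
  rewrite eD eS => h.
  have e4 : (2 - 2 * s) * (2 + 2 * s) = 4 * (1 - s ^+ 2) by ring.
  rewrite -[leLHS]ger0_norm; last by apply: sumr_ge0 => t _; rewrite mulr_ge0.
  rewrite -sqrtr_sqr; apply: le_trans (ler_wsqrtr h) _; rewrite e4.
  by rewrite sqrtrM // (_ : 4 = 2 ^+ 2 :> R) ?sqrtr_sqr ?ger0_norm //; ring.
have -> : (hi - lo) * Num.sqrt (1 - s ^+ 2) = (hi - lo) / 2 * (2 * Num.sqrt (1 - s ^+ 2)) by field.
apply: (@le_trans _ _ ((hi - lo) / 2 * \sum_t `|x t - y t| * `|x t + y t|)); last first.
  by apply: ler_wpM2l => //; rewrite divr_ge0 // subr_ge0.
have -> : \sum_t d t * x t ^+ 2 - \sum_t d t * y t ^+ 2 =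
  \sum_t (d t - (lo + hi) / 2) * ((x t - y t) * (x t + y t)).
  transitivity (\sum_t d t * x t ^+ 2 - \sum_t d t * y t ^+ 2
     - (lo + hi) / 2 * (\sum_t x t ^+ 2 - \sum_t y t ^+ 2)).
    by rewrite nx ny subrr mulr0 subr0.
  rewrite -!sumrB mulr_sumr -sumrB; apply: eq_bigr => t _; ring.
rewrite mulr_sumr; apply: le_trans (ler_norm_sum _ _ _) _.
apply: ler_sum => t _; rewrite !normrM; apply: ler_wpM2r.
  by rewrite mulr_ge0.
by have /andP[? ?] := dlh t; rewrite ler_norml; apply/andP; split; lra.
Qed.

Lemma expectation_gap (T : finType) (d : T -> R) (x y : T -> C) (lo hi : R) :
  let nrm (z : T -> C) t := complex.Re (conjc (z t) * z t) in
  let s := complex.Re (\sum_t conjc (x t) * y t) in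
  (forall t, lo <= d t <= hi) -> lo <= hi ->
  \sum_t nrm x t = 1 -> \sum_t nrm y t = 1 ->
  s ^+ 2 <= 1 /\
  `|\sum_t d t * nrm x t - \sum_t d t * nrm y t| <= (hi - lo) * Num.sqrt (1 - s ^+ 2).
Proof.
move=> nrm s dlh lh.
(* Complex amplitudes on T are real amplitudes on T * bool; the real part of the Hermitian product
   becomes the Euclidean product, which reduces to the real case. *)
pose p (z : T -> C) (t : T * bool) := if t.2 then complex.Re (z t.1) else complex.Im (z t.1).
have pE (c : T -> R) z w : \sum_t c t * complex.Re (conjc (z t) * w t) = \sum_t c t.1 * (p z t * p w t).
  rewrite -(pair_bigA _ (fun t b => c t * (p z (t, b) * p w (t, b)))) /=.
  apply: eq_bigr => t _; rewrite big_bool /p /=.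
  by case: (z t) (w t) => a b [a' b'] /=; ring.
have pE1 z w : \sum_t complex.Re (conjc (z t) * w t) = \sum_t (p z t * p w t).
  have := pE (fun=> 1) z w; under eq_bigr do rewrite mul1r; move=> ->.
  by apply: eq_bigr => t _; rewrite mul1r.
have nE c z : \sum_t c t * nrm z t = \sum_t c t.1 * p z t ^+ 2.
  by rewrite pE; apply: eq_bigr => t _; rewrite expr2.
have nE1 z : \sum_t nrm z t = \sum_t p z t ^+ 2.
  by rewrite pE1; apply: eq_bigr => t _; rewrite expr2.
rewrite !nE !nE1 /s Re_sum pE1 => nx ny.
exact: (@expectation_gap_real _ (fun t => d t.1) (p x) (p y) lo hi (fun t => dlh t.1) lh nx ny).
Qed.
End ExpectationGap.

(** * Environment states after noise and recovery *)

Section KnillLaflamme.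
Variable R : realType.
Local Notation C := (R[i]).

Lemma mxadj_mulE n (u v : 'cV[C]_n) : (mxadj u *m v) 0 0 = \sum_m conjc (u m 0) * v m 0.
Proof. by rewrite mxE; apply: eq_bigr => m _; rewrite mxadjE. Qed.

Lemma sum_triple (M : nmodType) (I J K : finType) (F : I -> J -> K -> M) :
  \sum_(t : I * J * K) F t.1.1 t.1.2 t.2 = \sum_i \sum_j \sum_k F i j k.
Proof.
rewrite pair_bigA /= -(pair_bigA _ (fun p k => F p.1 p.2 k)) /=.
by [].
Qed.

Lemma Re_conjcM_ge0 (z : C) : 0 <= complex.Re (conjc z * z).
Proof. by have := conjcM_ge0 z; rewrite lecE => /andP[]. Qed.

(** Midpoint concavity of c -> sqrt (1 - c^2), the midpoint of [c1] and [c2] being sqrt A. *)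
Lemma sqrt_onem_sqrD_le (A c1 c2 : R) : 0 <= A ->
  c1 ^+ 2 <= 1 -> c2 ^+ 2 <= 1 -> c1 + c2 = 2 * Num.sqrt A ->
  Num.sqrt (1 - c1 ^+ 2) + Num.sqrt (1 - c2 ^+ 2) <= 2 * Num.sqrt (1 - A).
Proof.
move=> A0 h1 h2 e.
have eA : A = ((c1 + c2) / 2) ^+ 2 by rewrite e -[LHS](sqr_sqrtr A0); field.
set s1 := Num.sqrt _; set s2 := Num.sqrt (1 - c2 ^+ 2).
have e1 : s1 ^+ 2 = 1 - c1 ^+ 2 by rewrite sqr_sqrtr // subr_ge0.
have e2 : s2 ^+ 2 = 1 - c2 ^+ 2 by rewrite sqr_sqrtr // subr_ge0.
have s10 : 0 <= s1 by apply: sqrtr_ge0.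
have s20 : 0 <= s2 by apply: sqrtr_ge0.
rewrite -[leLHS]ger0_norm ?addr_ge0 // -sqrtr_sqr.
rewrite -{1}[2]ger0_norm // -sqrtr_sqr -sqrtrM ?sqr_ge0 //; apply: ler_wsqrtr.
rewrite eA; have := sqr_ge0 (s1 - s2); have := sqr_ge0 (c1 - c2); nra.
Qed.

(* The states Phi_b = sum_(i,l) (Rl l K_i V e_b) (x) |i,l> of system and environment
   are both close to the products Psi_b = e_b (x) a / |a|, in which the environment
   no longer depends on b. *)
Lemma knill_laflamme_gap (dL dS : nat) (I L : finType) (V : 'M[C]_(dS, dL))
    (K : I -> 'M[C]_dS) (Rl : L -> 'M[C]_(dL, dS)) (e : bool -> 'cV[C]_dL)
    (d : I -> R) (lo hi : R) :
  let a i l := 2^-1%:C * \sum_b (mxadj (e b) *m (Rl l *m K i *m V) *m e b) 0 0 in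
  let E b := complex.Re ((mxadj (V *m e b) *m (\sum_i (d i)%:C *: (mxadj (K i) *m K i)) *m (V *m e b)) 0 0) in
  (forall i, lo <= d i <= hi) -> lo <= hi ->
  \sum_i mxadj (K i) *m K i = 1%:M -> \sum_l mxadj (Rl l) *m Rl l = 1%:M ->
  mxadj V *m V = 1%:M -> (forall b, mxadj (e b) *m e b = 1%:M) ->
  E true - E false <=
    2 * Num.sqrt (1 - \sum_i \sum_l complex.Re (conjc (a i l) * a i l)) * (hi - lo).
Proof.
move=> a E dlh lh KK RR VV ee.
pose Phi b (t : I * L * 'I_dL) := (Rl t.1.2 *m K t.1.1 *m V *m e b) t.2 0.
have PhiE b (c : I -> R) :
    \sum_t c t.1.1 * complex.Re (conjc (Phi b t) * Phi b t) =
    complex.Re ((mxadj (V *m e b) *m (\sum_i (c i)%:C *: (mxadj (K i) *m K i)) *m (V *m e b)) 0 0).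
  rewrite (sum_triple (fun i l m => c i * complex.Re (conjc ((Rl l *m K i *m V *m e b) m 0) * (Rl l *m K i *m V *m e b) m 0))).
  rewrite mulmx_sumr mulmx_suml summxE Re_sum; apply: eq_bigr => i _.
  rewrite -scalemxAr -scalemxAl mxE ReZ.
  transitivity (c i * \sum_l complex.Re ((mxadj (Rl l *m K i *m V *m e b) *m (Rl l *m K i *m V *m e b)) 0 0)).
    by rewrite mulr_sumr; apply: eq_bigr => l _; rewrite mxadj_mulE Re_sum mulr_sumr.
  congr (_ * _); rewrite -Re_sum -summxE; congr (complex.Re (fun_of_matrix _ _ _)).
  transitivity (mxadj (K i *m V *m e b) *m (\sum_l mxadj (Rl l) *m Rl l) *m (K i *m V *m e b)).
    rewrite mulmx_sumr mulmx_suml; apply: eq_bigr => l _.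
    by rewrite !mxadjM !mulmxA.
  by rewrite RR mulmx1 !mxadjM !mulmxA.
have nPhi b : \sum_t complex.Re (conjc (Phi b t) * Phi b t) = 1.
  have := PhiE b (fun=> 1); under eq_bigr do rewrite mul1r; move=> ->.
  under eq_bigr do rewrite scale1r.
  by rewrite KK mulmx1 mxadjM mulmxA -[_ *m mxadj V *m V]mulmxA VV mulmx1 ee mxE.
set A := \sum_i _.
have A0 : 0 <= A.
  by do 2!apply: sumr_ge0 => ? _; exact: Re_conjcM_ge0.
(* For A = 0 the product states cannot be normalised, but then the right-hand side is 2 (hi - lo)
   and the trivial bound hi - lo on the difference suffices. *)
have [zA|nA] := eqVneq A 0.
  rewrite zA subr0 sqrtr1 mulr1.
  have bnd b : lo <= E b <= hi.
    rewrite /E -PhiE -[lo]mulr1 -[hi]mulr1 -(nPhi b) !mulr_sumr.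
    apply/andP; split; apply: ler_sum => t _; apply: ler_wpM2r;
      by [exact: Re_conjcM_ge0 | have /andP[] := dlh t.1.1].
  have /andP[lt0 lt1] := bnd true; have /andP[lf0 lf1] := bnd false.
  by move: (E true) (E false) lt0 lt1 lf0 lf1 lh => x y; clear; lra.
pose r := Num.sqrt A.
have r0 : 0 < r by rewrite sqrtr_gt0 lt_def nA.
have rr : r * r = A by rewrite -expr2 sqr_sqrtr.
pose Psi b (t : I * L * 'I_dL) := r^-1%:C * a t.1.1 t.1.2 * e b t.2 0.
have PsiE b (c : I -> R) :
    \sum_t c t.1.1 * complex.Re (conjc (Psi b t) * Psi b t) =
    \sum_i \sum_l c i * (A^-1 * complex.Re (conjc (a i l) * a i l)).
  rewrite (sum_triple (fun i l m => c i * complex.Re (conjc (r^-1%:C * a i l * e b m 0) * (r^-1%:C * a i l * e b m 0)))).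
  apply: eq_bigr => i _; apply: eq_bigr => l _; rewrite -mulr_sumr; congr (_ * _).
  rewrite -Re_sum -ReZ; congr complex.Re.
  transitivity (A^-1%:C * (conjc (a i l) * a i l) * (mxadj (e b) *m e b) 0 0); last first.
    by rewrite ee mxE mulr1.
  rewrite mxadj_mulE mulr_sumr; apply: eq_bigr => m _.
  rewrite !conjcM conjc_real -rr invfM (rmorphM (real_complex R)) /=; ring.
have nPsi b : \sum_t complex.Re (conjc (Psi b t) * Psi b t) = 1.
  have := PsiE b (fun=> 1); under eq_bigr do rewrite mul1r; move=> ->.
  transitivity (A^-1 * A); last by rewrite mulVf.
  by rewrite mulr_sumr; apply: eq_bigr => i _; rewrite mulr_sumr; apply: eq_bigr => l _; rewrite mul1r.
pose s b := complex.Re (\sum_t conjc (Psi b t) * Phi b t).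
(* [a] averages the diagonal overlaps over b, so the two inner products add up to 2 A / r. Only
   their sum is controlled, which is why the concavity bound is needed. *)
have sE : s true + s false = 2 * r.
  have sb b : s b = \sum_i \sum_l r^-1 * complex.Re (conjc (a i l) * (mxadj (e b) *m (Rl l *m K i *m V) *m e b) 0 0).
    rewrite /s (sum_triple (fun i l m => conjc (r^-1%:C * a i l * e b m 0) * (Rl l *m K i *m V *m e b) m 0)).
    rewrite Re_sum; apply: eq_bigr => i _; rewrite Re_sum; apply: eq_bigr => l _.
    rewrite -ReZ; congr complex.Re.
    rewrite -[mxadj (e b) *m _ *m e b]mulmxA mxadj_mulE !mulr_sumr; apply: eq_bigr => m _.
    by rewrite !conjcM conjc_real; ring.
  rewrite !sb -big_split /=.
  transitivity (2 * r^-1 * A); last by rewrite -rr; field; rewrite gt_eqF.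
  rewrite mulr_sumr; apply: eq_bigr => i _.
  rewrite -big_split mulr_sumr /=; apply: eq_bigr => l _.
  rewrite -mulrDr -mulrA [2 * _]mulrC -mulrA; congr (_ * _).
  have -> : forall z w : C, complex.Re z + complex.Re w = complex.Re (z + w) by case=> ? ? [].
  rewrite -mulrDr mulrC -ReZ; congr complex.Re.
  rewrite {3}/a big_bool /= mulrCA; congr (_ * _).
  rewrite mulrA; have -> : 2%:C * 2^-1%:C = 1 :> C; last by rewrite mul1r.
  by apply/eqP; rewrite eq_complex /=; apply/andP; split; apply/eqP; field.
(* Each Phi b is compared with its own Psi b; the expectations of d in Psi true and Psi false
   coincide and cancel in the difference. *)
have [s1 g1] := @expectation_gap _ _ (fun t => d t.1.1) (Psi true) (Phi true) lo hi (fun t => dlh t.1.1) lh (nPsi true) (nPhi true).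
have [s2 g2] := @expectation_gap _ _ (fun t => d t.1.1) (Psi false) (Phi false) lo hi (fun t => dlh t.1.1) lh (nPsi false) (nPhi false).
move: g1 g2; rewrite !PhiE !PsiE -/(E true) -/(E false) -/(s true) -/(s false).
have := sqrt_onem_sqrD_le A0 s1 s2 sE.
move: (E true) (E false) (\sum_i _) (Num.sqrt _) (Num.sqrt _) (Num.sqrt _) lh.
clear => x y G q q1 q2 lh hq.
rewrite !ler_norml => /andP[k1 _] /andP[_ k2].
have : (hi - lo) * (q1 + q2) <= (hi - lo) * (2 * q) by apply: ler_wpM2l; rewrite ?subr_ge0 // addrC.
lra.
Qed.
End KnillLaflamme.

(** * Entangled probe states *)

Section EntangledProbe.
Variable R : realType.
Local Notation C := (R[i]).

Definition bool_ord (b : bool) : 'I_2 := inord b.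

Lemma bool_ord_inj : injective bool_ord.
Proof. by move=> [] [] // /(congr1 val); rewrite /= !inordK. Qed.

Lemma tens_sandwich m p (u u' : 'cV[C]_m) (v v' : 'cV[C]_p) (A : 'M[C]_m) (B : 'M[C]_p) :
  (mxadj (u *t v : 'cV_(m * p)) *m (A *t B) *m (u' *t v' : 'cV_(m * p))) 0 0 =
  (mxadj u *m A *m u') 0 0 * (mxadj v *m B *m v') 0 0.
Proof.
have -> : mxadj (u *t v : 'cV_(m * p)) *m (A *t B) *m (u' *t v' : 'cV_(m * p)) =
  (mxadj u *m A *m u') *t (mxadj v *m B *m v') :> 'M_(1 * 1).
  by rewrite -!tensmx_mul -mxadj_tens.
by rewrite !mxE !ord1.
Qed.

(* The maximally entangled vector of e and a reference qubit: the reference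
   removes the cross terms <e true, M e false>. *)
Definition probe n (e : bool -> 'cV[C]_n) : 'cV[C]_(n * 2) :=
  (Num.sqrt 2^-1)%:C *: \sum_b (e b *t (delta_mx (bool_ord b) 0 : 'cV[C]_2)).

Lemma mxadj_delta m n (i : 'I_m) (j : 'I_n) : mxadj (delta_mx i j) = delta_mx j i :> 'M[C]_(n, m).
Proof. by apply/matrixP=> a b; rewrite mxadjE !mxE andbC; case: (_ && _); rewrite ?conjc1 ?conjc0. Qed.

Lemma probe_form n (e : bool -> 'cV[C]_n) (M : 'M[C]_n) :
  (mxadj (probe e) *m (M *t (1%:M : 'M[C]_2)) *m probe e) 0 0 =
  2^-1%:C * \sum_b (mxadj (e b) *m M *m e b) 0 0.
Proof.
rewrite /probe mxadjZ -!scalemxAl -scalemxAr scalerA conjc_real -(rmorphM (real_complex R)) /=.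
rewrite -expr2 sqr_sqrtr ?invr_ge0 //  mxE; congr (_ * _).
rewrite mxadj_sum mulmx_suml mulmx_suml summxE; apply: eq_bigr => b _.
rewrite mulmx_sumr summxE (bigD1 b) //= big1 ?addr0.
  by rewrite tens_sandwich mulmx1 mxadj_delta mul_delta_mx [delta_mx _ _ _ _]mxE mulr1.
move=> b' nb; rewrite tens_sandwich mulmx1 mxadj_delta mul_delta_mx_0 ?mxE ?mulr0 //.
by apply: contra nb => /eqP/bool_ord_inj ->.
Qed.

Lemma tens_mx1 m p : (1%:M : 'M[C]_m) *t (1%:M : 'M[C]_p) = 1%:M.
Proof.
apply/matrixP => i j; case: (mxtens_indexP i) => i0 i1; case: (mxtens_indexP j) => j0 j1.
rewrite tensmxE !mxE (can_eq (@mxtens_indexK m p)) xpair_eqE -mulnb natrM.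
by [].
Qed.

Lemma probe_unit n (e : bool -> 'cV[C]_n) : (forall b, mxadj (e b) *m e b = 1%:M) ->
  mxadj (probe e) *m probe e = 1%:M.
Proof.
move=> ee; apply/matrixP => i j; rewrite !ord1 [RHS]mxE.
have := probe_form e 1%:M; rewrite tens_mx1 mulmx1 => ->.
under eq_bigr do rewrite mulmx1 ee mxE.
by rewrite big_bool /= -mulr2n mulr1n; apply/eqP; rewrite eq_complex /=; apply/andP; split; apply/eqP; field.
Qed.

Lemma chan_pdist_ge0 m n (Ks1 Ks2 : seq 'M[C]_(n, m)) : 0 <= chan_pdist Ks1 Ks2.
Proof.
rewrite /chan_pdist; set S := (X in sup X).
(* If there is no input state at all, the supremum is that of the empty set, which is 0. *)
have [->|/set0P [x Sx]] := eqVneq S classical_sets.set0; first by rewrite sup0.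
apply: (@le_trans _ _ x); first by have [r [rho [_ ->]]] := Sx; exact: sqrtr_ge0.
by apply: ub_le_sup => //; exists 1 => _ [r [rho [_ ->]]]; exact: pdist_le1.
Qed.

(** On a pure probe the single-operator channel [B] has pure output, so [fidelity_pure] turns the
    squared fidelity into the sum of the squared overlaps [z K]. The function [z] lets a caller
    supply these overlaps in evaluated form. *)
Lemma chan_pdist_ge m n (Ks : seq 'M[C]_(n, m)) (B : 'M[C]_(n, m)) r (psi : 'cV[C]_(m * r))
    (z : 'M[C]_(n, m) -> C) :
  mxadj psi *m psi = 1%:M ->
  (forall K, z K = (mxadj psi *m ((mxadj B *m K) *t (1%:M : 'M[C]_r)) *m psi) 0 0) ->
  1 - \sum_(K <- Ks) complex.Re (conjc (z K) * z K) <= chan_pdist Ks [:: B] ^+ 2.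
Proof.
move=> psi1 ez.
pose rho := psi *m mxadj psi.
have drho : density rho.
  by split; [exact: psd_rank1 | rewrite /rho mxtrace_mulC psi1 mxtrace1].
pose phi (K : 'M[C]_(n, m)) := (K *t (1%:M : 'M[C]_r)) *m psi.
have ext K : (K *t (1%:M : 'M[C]_r)) *m rho *m mxadj (K *t (1%:M : 'M[C]_r)) = phi K *m mxadj (phi K).
  by rewrite /rho /phi mxadjM !mulmxA.
have hp : pdist (apply_ext Ks rho) (apply_ext [:: B] rho) <= chan_pdist Ks [:: B].
  apply: ub_le_sup; first by exists 1 => _ [s [sigma [_ ->]]]; exact: pdist_le1.
  by exists r, rho.
have psd1 : psd (apply_ext Ks rho).
  rewrite /apply_ext; elim: Ks {hp} => [|K Ks [h1 h2]].
    rewrite big_nil; have := psd_rank1 (0 : 'cV[C]_(n * r)); by rewrite mul0mx.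
  rewrite big_cons ext; have [g1 g2] := psd_rank1 (phi K).
  split; first by rewrite /herm_mx mxadjD g1 h1.
  move=> v; rewrite mulmxDr mulmxDl mxE.
  by rewrite ReD addr_ge0 ?g2 ?h2.
have ff : fidelity (apply_ext Ks rho) (apply_ext [:: B] rho) ^+ 2 =
    \sum_(K <- Ks) complex.Re (conjc (z K) * z K).
  rewrite {2}/apply_ext big_seq1 ext fidelity_pure // sqr_sqrtr; last by have [_] := psd1; apply.
  rewrite /apply_ext mulmx_sumr mulmx_suml summxE Re_sum; apply: eq_bigr => K _.
  rewrite ext; congr complex.Re.
  have zE : mxadj (phi B) *m phi K = (z K)%:M.
    rewrite [LHS]mx11_scalar; congr (_%:M); rewrite ez /phi; congr (fun_of_matrix _ _ _).
    rewrite mxadjM mxadj_tens mxadj1 !mulmxA -[mxadj psi *m _ *m _]mulmxA tensmx_mul mulmx1.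
    by rewrite ?mulmxA.
  have zE' : mxadj (phi K) *m phi B = (conjc (z K))%:M.
    have := congr1 (@mxadj R 1 1) zE; rewrite mxadjM mxadjK => ->.
    by apply/matrixP => i j; rewrite !mxE !ord1 eqxx.
  have -> : mxadj (phi B) *m (phi K *m mxadj (phi K)) *m phi B =
    (mxadj (phi B) *m phi K) *m (mxadj (phi K) *m phi B) by rewrite !mulmxA.
  rewrite zE zE' -scalar_mxM mxE eqxx mulr1n mulrC //.
rewrite -ff; move: hp; rewrite /pdist; set f := fidelity _ _ => hp.
(* That the fidelity is at most 1 is never proved: if 1 - f^2 is negative, the lower bound is
   trivial. *)
have [h|h] := leP 0 (1 - f ^+ 2).
  by rewrite -[leLHS](sqr_sqrtr h) lerXn2r ?nnegrE ?sqrtr_ge0 ?chan_pdist_ge0.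
by apply: le_trans (ltW h) _; apply: sqr_ge0.
Qed.

End EntangledProbe.

(** * Quasiperiodic functions *)

Section Quasiperiodic.
Variable R : realType.

(** Dirichlet kernel: 2 sin (x/2) cos (n x) = sin ((n + 1/2) x) - sin ((n - 1/2) x) telescopes. *)
Lemma sum_cos_telescope (x : R) N :
  2 * sin (x / 2) * \sum_(n < N) cos (n%:R * x) =
  sin (N%:R * x - x / 2) + sin (x / 2).
Proof.
elim: N => [|N IH]; first by rewrite big_ord0 mulr0 mul0r add0r sinN addNr.
rewrite big_ord_recr /= mulrDr IH -[N.+1%:R]natr1.
have -> : (N%:R + 1) * x - x / 2 = N%:R * x + x / 2 by field.
rewrite sinB sinD; ring.
Qed.

(** The bound is uniform in N; [|x| <= 1] keeps x/2 away from the other zeros of the sine. *)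
Lemma sum_cos_le (x : R) N : x != 0 -> `|x| <= 1 ->
  \sum_(n < N) cos (n%:R * x) <= `|sin (x / 2)|^-1.
Proof.
move=> x0 x1.
have s0 : 0 < `|sin (x / 2)|.
  have h : 0 < `|x| / 2 < 2.
    by rewrite divr_gt0 ?normr_gt0 //= ltr_pdivrMr //; apply: le_lt_trans x1 _; lra.
  have := sin2_gt0 h; rewrite normr_gt0.
  by case: (ger0P x) h => _ _; rewrite ?mulNr ?sinN ?oppr_gt0; [move/gt_eqF=> -> | move/lt_eqF => ->].
apply: le_trans (ler_norm _) _.
rewrite -(ler_pM2l s0) divff ?gt_eqF // -normrM.
have := sum_cos_telescope x N.
have := sin_max (N%:R * x - x / 2); have := sin_max (x / 2).
move: (\sum_(n < N) _) => S; move: (sin (x / 2)) (sin _) => a b.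
by rewrite !ler_norml => /andP[? ?] /andP[? ?] e; apply/andP; split; lra.
Qed.

(** Archimedean limit: a bounded error disappears after division by N. *)
Lemma le_of_mulrn_le (c e k : R) : (forall N, N%:R * c <= N%:R * e + k) -> c <= e.
Proof.
move=> h; rewrite leNgt; apply/negP => lt.
have d0 : 0 < c - e by rewrite subr_gt0.
have := h (Num.bound (`|k| / (c - e))).
have := archi_boundP (divr_ge0 (normr_ge0 k) (ltW d0)).
rewrite ltr_pdivrMr // mulrBr; have := ler_norm k; lra.
Qed.

(* Average over th = n / M, with M so large that no nonzero difference of
   frequencies is a multiple of 2 pi M: the off-diagonal sums of cosines stay
   bounded in the number of samples. *)
Lemma quasiperiodic_average (T : finType) (w mu : T -> R) (c : R) :
  (forall t, 0 <= w t) ->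
  (forall th, c <= \sum_t \sum_s w t * w s * cos ((mu t - mu s) * th)) ->
  c <= \sum_t \sum_(s | mu s == mu t) w t * w s.
Proof.
move=> w0 hc.
pose M := 1 + \sum_t \sum_s `|mu t - mu s|.
have M1 t s : `|mu t - mu s| <= M.
  apply: (@le_trans _ _ (\sum_t \sum_s `|mu t - mu s|)); last by rewrite /M lerDr.
  rewrite (bigD1 t) //= (bigD1 s) //= -addrA lerDl addr_ge0 ?sumr_ge0 // => u _.
  by rewrite sumr_ge0.
have M0 : 0 < M.
  by apply: lt_le_trans ltr01 _; rewrite lerDl; do 2!apply: sumr_ge0 => ? _.
pose x t s := (mu t - mu s) / M.
apply: (@le_of_mulrn_le _ _ (\sum_t \sum_s w t * w s * `|sin (x t s / 2)|^-1)) => N.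
have : \sum_(n < N) c <= \sum_(n < N) \sum_t \sum_s w t * w s * cos (n%:R * x t s).
  apply: ler_sum => n _; apply: le_trans (hc (n%:R / M)) _.
  apply: ler_sum => t _; apply: ler_sum => s _.
  by rewrite le_eqVlt; apply/orP; left; apply/eqP; congr (_ * cos _); rewrite /x; ring.
rewrite sumr_const card_ord mulr_natl => /le_trans; apply.
rewrite exchange_big /= mulr_sumr.
rewrite -[leRHS](@big_split _ _ +%R); apply: ler_sum => t _ /=.
rewrite exchange_big /= [X in _ * X + _]big_mkcond mulr_sumr -[leRHS](@big_split _ _ +%R); apply: ler_sum => s _ /=.
rewrite -mulr_sumr; have ww : 0 <= w t * w s by rewrite mulr_ge0.
case: eqP => [e|/eqP ne].
  rewrite /x e subrr mul0r; under eq_bigr do rewrite mulr0 cos0.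
  rewrite sumr_const card_ord -[1 *+ N]/(N%:R) mulrC lerDl mulr_ge0 //.
  by rewrite invr_ge0.
rewrite mulr0 add0r; apply: ler_wpM2l => //; apply: sum_cos_le.
  by rewrite mulf_eq0 invr_eq0 (gt_eqF M0) orbF subr_eq0 eq_sym.
by rewrite normrM normfV (gtr0_norm M0) ler_pdivrMr // mul1r.
Qed.

(** Take the frequency of largest total weight W. The hypothesis bounds c by a weighted mean of
    class weights, hence by W. Every other class lies in the complement of the heaviest one and so
    weighs at most 1 - W, which gives the quadratic bound. *)
Lemma dominant_frequency (T : finType) (w mu : T -> R) (c : R) :
  (forall t, 0 <= w t) -> \sum_t w t = 1 ->
  c <= \sum_t \sum_(s | mu s == mu t) w t * w s ->
  exists m, let W := \sum_(s | mu s == m) w s in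
    c <= W /\ c <= W ^+ 2 + (1 - W) ^+ 2.
Proof.
move=> w0 w1 hc.
have [t0 _|T0] := pickP T; last by move: w1; rewrite big_pred0 // => /eqP; rewrite eq_sym oner_eq0.
pose W t := \sum_(s | mu s == mu t) w s.
pose t1 := [arg max_(t > t0) W t]%O.
have hW t : W t <= W t1 by rewrite /t1; case: arg_maxP => // j _; apply.
have hc' : c <= \sum_t w t * W t.
  by apply: le_trans hc _; apply: ler_sum => t _; rewrite mulr_sumr.
have split : \sum_(s | mu s != mu t1) w s = 1 - W t1.
  by rewrite -w1 [X in _ = X - _](bigID (fun s => mu s == mu t1)) /= addrAC subrr add0r.
exists (mu t1); split.
  apply: le_trans hc' _; rewrite -[leRHS]mul1r -w1 mulr_suml.
  by apply: ler_sum => t _; apply: ler_wpM2l.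
apply: le_trans hc' _; rewrite (bigID (fun s => mu s == mu t1)) /=; apply: lerD.
  rewrite expr2 -/(W t1) {1}/W mulr_suml; apply: ler_sum => t /eqP e.
  by rewrite /W e.
rewrite expr2 -/(W t1) -{1}split mulr_suml; apply: ler_sum => t ne.
apply: ler_wpM2l => //; rewrite -split /W big_mkcond [leRHS]big_mkcond /=.
apply: ler_sum => s _; case: eqP => [->|_]; first by rewrite ne.
by case: ifP.
Qed.

(** The right-hand side in the hypothesis on [th] is |g(th)|^2, a double sum of cosines of frequency
    differences, so one frequency m dominates. With eta = 1 - W, W^2 + (1 - W)^2 = 1 - 2 eta (1 -
    eta). *)
Lemma quasiperiodic_energy_gap (I : finType) (p : bool -> I -> R) (d : I -> R)
    (E : bool -> R) (lo hi a : R) :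
  (forall b i, 0 <= p b i) -> (forall b, \sum_i p b i = 1) ->
  (forall i, lo <= d i <= hi) -> 0 <= a < 1 / 16 ->
  (forall th, 1 - a <=
     ((\sum_b \sum_i p b i * cos ((E b - d i) * th)) / 2) ^+ 2 +
     ((\sum_b \sum_i p b i * sin ((E b - d i) * th)) / 2) ^+ 2) ->
  exists eta, [/\ 0 <= eta <= 1 / 16, 2 * eta * (1 - eta) <= a
    & E true - E false - (\sum_i p true i * d i - \sum_i p false i * d i)
        <= 2 * eta * (hi - lo)].
Proof.
move=> p0 p1 dlh /andP[a0 a1] hth.
pose w (t : bool * I) := p t.1 t.2 / 2; pose mu (t : bool * I) := E t.1 - d t.2.
have w0 t : 0 <= w t by rewrite divr_ge0.
have sw (F : bool -> I -> R) : \sum_(t : bool * I) w t * F t.1 t.2 = (\sum_b \sum_i p b i * F b i) / 2.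
  rewrite pair_bigA mulr_suml; apply: eq_bigr => t _; rewrite /w; ring.
have w1 : \sum_t w t = 1.
  have := sw (fun _ _ => 1); under eq_bigr do rewrite mulr1; move=> ->.
  under eq_bigr => b _ do (under eq_bigr do rewrite mulr1; rewrite p1).
  by rewrite big_bool /=; lra.
have h th : 1 - a <= \sum_t \sum_s w t * w s * cos ((mu t - mu s) * th).
  apply: le_trans (hth th) _.
  rewrite -(sw (fun b i => cos ((E b - d i) * th))) -(sw (fun b i => sin ((E b - d i) * th))).
  rewrite !expr2 !big_distrlr /= -big_split /=; apply: ler_sum => t _.
  rewrite -big_split /=; apply: ler_sum => s _.
  by rewrite /mu [(_ - (_ - _)) * th]mulrBl cosB le_eqVlt; apply/orP; left; apply/eqP; ring.
have [m [W1 W2]] := dominant_frequency w0 w1 (quasiperiodic_average w0 h).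
pose q b := \sum_(i | E b - d i == m) p b i.
set W := \sum_(s | _) _ in W1 W2.
have WE : W = (q true + q false) / 2.
  rewrite /W big_mkcond /=.
  have -> : (q true + q false) = \sum_b \sum_i p b i * (if E b - d i == m then 1 else 0).
    rewrite big_bool /q /=; congr (_ + _); rewrite big_mkcond; apply: eq_bigr => i _;
    by case: ifP; rewrite ?mulr1 ?mulr0.
  rewrite -(sw (fun b i => if E b - d i == m then 1 else 0)).
  by apply: eq_bigr => t _; rewrite /mu; case: ifP; rewrite ?mulr1 ?mulr0.
have qC b : \sum_(i | E b - d i != m) p b i = 1 - q b.
  by rewrite -(p1 b) [X in _ = X - _](bigID (fun i => E b - d i == m)) /= addrAC subrr add0r.
have q1 b : q b <= 1 by rewrite -subr_ge0 -qC sumr_ge0.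
have q1t := q1 true; have q1f := q1 false.
(* W > 15/16 and both weights are at most 1, so each exceeds 7/8. *)
have qpos b : 0 < q b by case: b; lra.
have key b : `|E b - m - \sum_i p b i * d i| <= (1 - q b) * (hi - lo).
  (* Positive weight forces some level [d i0] to equal E b - m exactly; the deviations become d i0 -
     d i and are at most hi - lo in modulus. *)
  have [i0 ei0] : exists i, E b - d i == m.
    apply/existsP; rewrite -[[exists _, _]]negbK negb_exists; apply/negP => /forallP hn.
    have := qpos b; rewrite /q big_pred0 ?ltxx // => i.
    by apply/negP => hi0; have := hn i; rewrite hi0.
  have -> : E b - m - \sum_i p b i * d i = \sum_i p b i * (E b - m - d i).
    rewrite -[E b - m]mul1r -{1}(p1 b) mulr_suml -sumrB.
    by apply: eq_bigr => i _; ring.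
  apply: le_trans (ler_norm_sum _ _ _) _.
  rewrite (bigID (fun i => E b - d i == m)) /= big1 ?add0r; last first.
    by move=> i /eqP <-; rewrite (_ : E b - (E b - d i) - d i = 0) ?mulr0 ?normr0 //; ring.
  rewrite -qC mulr_suml; apply: ler_sum => i _.
  rewrite normrM ger0_norm //; apply: ler_wpM2l => //.
  have /andP[l1 l2] := dlh i; have /andP[l3 l4] := dlh i0.
  move/eqP: ei0 => ei0; have -> : E b - m - d i = d i0 - d i by lra.
  by rewrite ler_norml; apply/andP; split; lra.
exists (1 - W); split.
- by apply/andP; split; lra.
- nra.
have := key true; have := key false; rewrite !ler_norml => /andP[k1 k2] /andP[k3 k4].
rewrite WE; lra.
Qed.
End Quasiperiodic.

(** * Bounds for covariant codes *)

Section CodeBounds.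
Variable R : realType.
Local Notation C := (R[i]).

Lemma chan_pdist_le1 m n (Ks1 Ks2 : seq 'M[C]_(n, m)) : chan_pdist Ks1 Ks2 <= 1.
Proof.
rewrite /chan_pdist; set S := (X in sup X).
have [->|S0] := eqVneq S classical_sets.set0; first by rewrite sup0 ler01.
by apply: ge_sup; [exact/set0P | move=> _ [r [rho [_ ->]]]; exact: pdist_le1].
Qed.

Lemma kraus_tp_fun n k (K : 'I_k -> 'M[C]_n) :
  kraus_tp (kraus_seq K) -> \sum_i mxadj (K i) *m K i = 1%:M.
Proof. by rewrite /kraus_tp /kraus_seq big_map big_enum. Qed.

Lemma sum_kraus_comp m n p (Ks2 : seq 'M[C]_(p, n)) (Ks1 : seq 'M[C]_(n, m))
    (F : 'M[C]_(p, m) -> R) :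
  \sum_(A <- kraus_comp Ks2 Ks1) F A = \sum_(A <- Ks2) \sum_(B <- Ks1) F (A *m B).
Proof. exact: (@big_allpairs_dep _ _ _ _ (fun=> _)). Qed.

(** The freedom to mix Kraus operators: a coefficient matrix diagonalised by [W] becomes diagonal
    for the mixed operators [L]. *)
Lemma kraus_mix n k (K : 'I_k -> 'M[C]_n) (W : 'M[C]_k) (c : 'I_k -> R) :
  let L a := \sum_i W a i *: K i in
  \sum_a (c a)%:C *: (mxadj (L a) *m L a) =
  \sum_i \sum_j (mxadj W *m diag_mx (\row_a (c a)%:C) *m W) i j *: (mxadj (K i) *m K j).
Proof.
move=> L; under [RHS]eq_bigr => i _ do under eq_bigr => j _ do rewrite spectral_entryE scaler_suml.
under [RHS]eq_bigr => i _ do rewrite exchange_big.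
rewrite exchange_big /=; apply: eq_bigr => a _.
rewrite /L mxadj_sum mulmx_suml scaler_sumr; apply: eq_bigr => i _.
rewrite mulmx_sumr scaler_sumr; apply: eq_bigr => j _.
rewrite mxadjZ -scalemxAl -scalemxAr !scalerA mxE; congr (_ *: _); ring.
Qed.

Lemma unitary_isometry k (W : 'M[C]_k) (a : 'I_k -> C) : mxadj W *m W = 1%:M ->
  \sum_b complex.Re (conjc (\sum_i W b i * a i) * (\sum_i W b i * a i)) =
  \sum_i complex.Re (conjc (a i) * a i).
Proof.
move=> W1; pose u : 'cV[C]_k := \col_i a i.
have := congr1 (fun M : 'M_1 => complex.Re (M 0 0)) (erefl (mxadj (W *m u) *m (W *m u))).
rewrite {2}mxadjM -[mxadj u *m _ *m _]mulmxA [mxadj W *m _]mulmxA W1 mul1mx !mxadj_mulE !Re_sum => e.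
transitivity (\sum_m complex.Re (conjc ((W *m u) m 0) * (W *m u) m 0)).
  apply: eq_bigr => b _; rewrite (_ : (W *m u) b 0 = \sum_i W b i * a i) //.
  by rewrite mxE; apply: eq_bigr => i _; rewrite mxE.
by rewrite e; apply: eq_bigr => i _; rewrite mxE.
Qed.

Lemma Delta_ge0 n (H : 'M[C]_n) : herm_mx H -> (0 < n)%N -> 0 <= Delta H.
Proof.
move=> /herm_spectral [Q [d [Q1 Q2 ->]]] n0.
have [i0 [i1 [h ->]]] := Delta_spectral d n0 Q1 Q2.
by have /andP[? _] := h i0; rewrite subr_ge0.
Qed.

Definition energy dL dS (V : 'M[C]_(dS, dL)) (H : 'M[C]_dS) (e : 'cV[C]_dL) : R :=
  complex.Re ((mxadj (V *m e) *m H *m (V *m e)) 0 0).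

(** Mixing by the eigenbasis of h makes H the sum of [d a] times [L a] squared, that is, an
    observable of the environment with values in an interval of length Delta h. The overlap sum of
    [knill_laflamme_gap] is then the squared fidelity on the probe. *)
Lemma qec_gap dL dS k (V : 'M[C]_(dS, dL)) (K : 'I_k -> 'M[C]_dS) (Rk : seq 'M[C]_(dL, dS))
    (h : 'M[C]_k) (H : 'M[C]_dS) (e : bool -> 'cV[C]_dL) : (0 < k)%N ->
  mxadj V *m V = 1%:M -> kraus_tp (kraus_seq K) -> kraus_tp Rk -> herm_mx h ->
  (forall b, mxadj (e b) *m e b = 1%:M) ->
  H = \sum_i \sum_j h i j *: (mxadj (K i) *m K j) ->
  energy V H (e true) - energy V H (e false) <=
    2 * chan_pdist (kraus_comp Rk (kraus_comp (kraus_seq K) [:: V])) [:: 1%:M] * Delta h.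
Proof.
move=> k0 VV /kraus_tp_fun KK RR hh ee HE.
have [W [d [W1 W2 eh]]] := herm_spectral hh.
have [i0 [i1 [hd De]]] := Delta_spectral d k0 W1 W2.
rewrite eh De.
pose L a := \sum_i W a i *: K i.
have LL : \sum_a mxadj (L a) *m L a = 1%:M.
  transitivity (\sum_a ((fun=> 1) a)%:C *: (mxadj (L a) *m L a)).
    by apply: eq_bigr => a _; exact: (esym (scale1r _)).
  rewrite kraus_mix.
  rewrite (_ : diag_mx _ = 1%:M); last by apply/matrixP => i j; rewrite !mxE.
  rewrite mulmx1 W1 -KK; apply: eq_bigr => i _.
  rewrite (bigD1 i) //= mxE eqxx scale1r big1 ?addr0 // => j ji.
  by rewrite mxE eq_sym (negPf ji) scale0r.
have HL : H = \sum_a (d a)%:C *: (mxadj (L a) *m L a) by rewrite kraus_mix -eh HE.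
pose Rl (l : 'I_(size Rk)) := Rk`_l.
have RRl : \sum_l mxadj (Rl l) *m Rl l = 1%:M.
  by rewrite -RR (big_nth 0) big_mkord.
have lh : d i1 <= d i0 by have /andP[] := hd i0.
have := knill_laflamme_gap hd lh LL RRl VV ee.
rewrite -HL -/(energy V H (e true)) -/(energy V H (e false)) => /le_trans; apply.
apply: ler_wpM2r; rewrite ?subr_ge0 // ler_pM2l //.
set x := chan_pdist _ _.
have x0 : 0 <= x by apply: chan_pdist_ge0.
rewrite -[leRHS]ger0_norm // -sqrtr_sqr; apply: ler_wsqrtr.
pose a i l := 2^-1%:C * \sum_b (mxadj (e b) *m (Rl l *m K i *m V) *m e b) 0 0.
have := @chan_pdist_ge R _ _ (kraus_comp Rk (kraus_comp (kraus_seq K) [:: V])) 1%:M 2 (probe e)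
  (fun A => 2^-1%:C * \sum_b (mxadj (e b) *m A *m e b) 0 0) (probe_unit ee).
rewrite -/x => hx.
apply: le_trans (hx _); last by move=> A; rewrite probe_form mxadj1 mul1mx.
rewrite le_eqVlt; apply/orP; left; apply/eqP; congr (1 - _).
rewrite [LHS]exchange_big /= sum_kraus_comp (big_nth 0) big_mkord; apply: eq_bigr => l _.
rewrite sum_kraus_comp /kraus_seq big_map big_enum /=.
under [RHS]eq_bigr => i _ do rewrite big_seq1 mulmxA -/(Rl l) -/(a i l).
(* The overlaps for [L] are a unitary mixture of those for [K], so their total squared modulus is
   the same. *)
apply: etrans (unitary_isometry (fun i => a i l) W1); apply: eq_bigr => b _.
suff -> : 2^-1%:C * \sum_b0 (mxadj (e b0) *m (Rl l *m L b *m V) *m e b0) 0 0 = \sum_i W b i * a i l by [].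
rewrite /a; under [RHS]eq_bigr => i _ do rewrite mulrCA mulr_sumr.
rewrite -mulr_sumr exchange_big /=; congr (_ * _); apply: eq_bigr => c _.
rewrite /L mulmx_sumr !mulmx_suml mulmx_sumr mulmx_suml summxE; apply: eq_bigr => i _.
by rewrite -scalemxAr -!scalemxAl -scalemxAr -scalemxAl mxE.
Qed.

Lemma covariance_gap dL dS (HL : 'M[C]_dL) (HS : 'M[C]_dS) (V : 'M[C]_(dS, dL)) :
  (0 < dL)%N -> (0 < dS)%N -> mxadj V *m V = 1%:M -> herm_mx HL -> herm_mx HS ->
  deltaG HL HS V < 1 / 4 ->
  exists (e : bool -> 'cV[C]_dL) (eta : R),
   [/\ forall b, mxadj (e b) *m e b = 1%:M,
       0 <= eta <= 1 / 16, 2 * eta * (1 - eta) <= deltaG HL HS V ^+ 2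
     & Delta HL - (energy V HS (e true) - energy V HS (e false)) <= 2 * eta * Delta HS].
Proof.
move=> dL0 dS0 VV hL hS dlt.
have [Q [E [Q1 Q2 eL]]] := herm_spectral hL.
have [P [d [P1 P2 eS]]] := herm_spectral hS.
have [i0 [i1 [_ DL]]] := Delta_spectral E dL0 Q1 Q2.
have [j0 [j1 [hd DS]]] := Delta_spectral d dS0 P1 P2.
(* [true] selects the largest eigenvalue of [HL] and [false] the smallest. *)
pose ib (b : bool) := if b then i0 else i1.
have [e [ee eU]] : exists e : bool -> 'cV[C]_dL,
    (forall b, mxadj (e b) *m e b = 1%:M) /\
    forall th b, Uop HL th *m e b = expi (th * E (ib b)) *: e b.
  exists (fun b => mxadj Q *m delta_mx (ib b) 0); split=> [b|th b].
    rewrite mxadjM mxadjK mulmxA -[_ *m Q *m _]mulmxA Q2 mulmx1 mxadj_delta mul_delta_mx.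
    by apply/matrixP => i j; rewrite !ord1 !mxE eqxx.
  rewrite eL Uop_spectral // !mulmxA -[_ *m Q *m _]mulmxA Q2 mulmx1 -mulmxA.
  rewrite scalemxAr; congr (_ *m _); apply/matrixP => i j.
  by rewrite mul_diag_mx !mxE; case: eqP => [->|_] //=; rewrite !mulr0.
pose w b := P *m (V *m e b).
pose p b n := complex.Re (conjc (w b n 0) * w b n 0).
have pE b n : conjc (w b n 0) * w b n 0 = (p b n)%:C.
  by rewrite /p; case: (w b n 0) => x y; apply/eqP; rewrite eq_complex /=; apply/andP; split; apply/eqP; ring.
have wd b (c : 'rV[C]_dS) : (mxadj (V *m e b) *m (mxadj P *m diag_mx c *m P) *m (V *m e b)) 0 0 =
    \sum_n (p b n)%:C * c 0 n.
  have -> : mxadj (V *m e b) *m (mxadj P *m diag_mx c *m P) *m (V *m e b) = mxadj (w b) *m (diag_mx c *m w b).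
    by rewrite /w !mxadjM !mulmxA.
  rewrite mxadj_mulE; apply: eq_bigr => n _; rewrite mul_diag_mx [X in _ * X]mxE -pE; ring.
have Ew b : energy V HS (e b) = \sum_n p b n * d n.
  by rewrite /energy eS wd Re_sum; apply: eq_bigr => n _; rewrite mxE ReZ.
have p1 b : \sum_n p b n = 1.
  rewrite /p -Re_sum -mxadj_mulE /w mxadjM mulmxA -[mxadj (V *m e b) *m _ *m _]mulmxA P1 mulmx1.
  by rewrite mxadjM !mulmxA -[_ *m _ *m V]mulmxA VV mulmx1 ee mxE.
set dl := deltaG HL HS V in dlt *.
have dge th : chan_pdist [:: Uop HS th *m V] [:: V *m Uop HL th] <= dl.
  apply: ub_le_sup; last by exists th.
  exists 1 => _ [t ->]; apply: chan_pdist_le1.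
have dl0 : 0 <= dl by apply: le_trans (dge 0); apply: chan_pdist_ge0.
(* The probe overlap of the two evolved encodings is g(th); its real and imaginary parts are the
   cosine and sine sums. *)
have key th : 1 - dl ^+ 2 <=
     ((\sum_b \sum_n p b n * cos ((E (ib b) - d n) * th)) / 2) ^+ 2 +
     ((\sum_b \sum_n p b n * sin ((E (ib b) - d n) * th)) / 2) ^+ 2.
  have := @chan_pdist_ge R _ _ [:: Uop HS th *m V] (V *m Uop HL th) 2 (probe e)
   (fun A => 2^-1%:C * \sum_b (mxadj (e b) *m (mxadj (V *m Uop HL th) *m A) *m e b) 0 0) (probe_unit ee).
  move=> /(_ (fun A => esym (probe_form e _))); rewrite big_seq1.
  have -> : 2^-1%:C * \sum_b (mxadj (e b) *m (mxadj (V *m Uop HL th) *m (Uop HS th *m V)) *m e b) 0 0 =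
    Complex ((\sum_b \sum_n p b n * cos ((E (ib b) - d n) * th)) / 2)
            ((\sum_b \sum_n p b n * sin ((E (ib b) - d n) * th)) / 2).
    transitivity (2^-1%:C * \sum_b \sum_n (p b n)%:C * Complex (cos ((E (ib b) - d n) * th)) (sin ((E (ib b) - d n) * th))).
      congr (_ * _); apply: eq_bigr => b _.
      have -> : mxadj (e b) *m (mxadj (V *m Uop HL th) *m (Uop HS th *m V)) *m e b =
        mxadj (Uop HL th *m e b) *m (mxadj V *m Uop HS th *m V *m e b).
        by rewrite !mxadjM !mulmxA.
      rewrite eU mxadjZ -scalemxAl mxE.
      have -> : mxadj (e b) *m (mxadj V *m Uop HS th *m V *m e b) = mxadj (V *m e b) *m Uop HS th *m (V *m e b).
        by rewrite !mxadjM !mulmxA.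
      rewrite eS Uop_spectral // wd mulr_sumr; apply: eq_bigr => n _.
      rewrite mxE mulrCA; congr (_ * _); rewrite /expi mulrBl cosB sinB !(mulrC th).
      by apply/eqP; rewrite eq_complex /=; apply/andP; split; apply/eqP; ring.
    apply/eqP; rewrite eq_complex; apply/andP; split; apply/eqP.
      rewrite ReZ Re_sum /= mulrC; congr (_ * _); apply: eq_bigr => b _.
      by rewrite Re_sum; apply: eq_bigr => n _; rewrite ReZ.
    rewrite ImZ Im_sum /= mulrC; congr (_ * _); apply: eq_bigr => b _.
    by rewrite Im_sum; apply: eq_bigr => n _; rewrite ImZ.
  move=> /= h.
  have : chan_pdist [:: Uop HS th *m V] [:: V *m Uop HL th] ^+ 2 <= dl ^+ 2.
    by rewrite lerXn2r ?nnegrE ?chan_pdist_ge0 ?dge.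
  rewrite -!expr2 in h; lra.
have a0 : 0 <= dl ^+ 2 < 1 / 16.
  by rewrite sqr_ge0 /=; nra.
have p0 b n : 0 <= p b n by exact: Re_conjcM_ge0.
have [eta [h1 h2 h3]] := quasiperiodic_energy_gap p0 p1 hd a0 key.
exists e, eta; split=> //.
by rewrite eL DL eS DS -eS !Ew; exact: h3.
Qed.
End CodeBounds.

(** * Infima over recoveries and Hermitian coefficient matrices *)

Section MainBounds.
Variable R : realType.
Local Notation C := (R[i]).

Lemma le_mul_inf (S : set R) (c D : R) : (S !=set0)%classic -> 0 <= D ->
  (forall x, S x -> c <= x * D) -> c <= inf S * D.
Proof.
move=> S0; rewrite le_eqVlt => /orP[/eqP <-|D0] h.
  by have [x Sx] := S0; rewrite mulr0 -(mulr0 x); exact: h.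
rewrite -ler_pdivrMr //; apply: lb_le_inf => // x Sx.
by rewrite ler_pdivrMr //; exact: h.
Qed.

Lemma Delta_gt0 n (H : 'M[C]_n) : (0 < n)%N -> herm_mx H -> nontrivial H -> 0 < Delta H.
Proof.
move=> n0 /herm_spectral [Q [d [Q1 Q2 eH]]] nt.
have [i0 [i1 [hd De]]] := Delta_spectral d n0 Q1 Q2.
rewrite eH De subr_gt0 lt_def; have /andP[-> _] := hd i0; rewrite andbT.
apply/negP => /eqP e; apply: nt; exists (d i0)%:C; rewrite eH.
have -> : \row_l (d l)%:C = const_mx (d i0)%:C.
  apply/rowP => l; rewrite !mxE; congr (_%:C); apply/eqP; rewrite eq_le.
  by have /andP[h1 ->] := hd l; rewrite e h1.
by rewrite diag_const_mx mul_mx_scalar -scalemxAl Q1 scale_scalar_mx mulr1.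
Qed.

(** Averaging the coefficients with their conjugate transpose still represents the Hermitian [H];
    hence the infimum defining [frakJ] runs over a nonempty set. *)
Lemma kraus_span_herm n k (K : 'I_k -> 'M[C]_n) (H : 'M[C]_n) : herm_mx H ->
  in_kraus_span K H ->
  exists h : 'M[C]_k, herm_mx h /\ H = \sum_i \sum_j h i j *: (mxadj (K i) *m K j).
Proof.
move=> hH [c ec]; exists (\matrix_(i, j) (2^-1%:C * (c i j + conjc (c j i)))); split.
  apply/matrixP => i j; rewrite mxadjE !mxE conjcM conjc_real; congr (_ * _).
  by rewrite rmorphD /= conjcK addrC.
have ec' : H = \sum_i \sum_j conjc (c j i) *: (mxadj (K i) *m K j).
  rewrite -[LHS]hH {1}ec mxadj_sum.
  under eq_bigr => i _ do rewrite mxadj_sum.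
  rewrite exchange_big /=; apply: eq_bigr => i _; apply: eq_bigr => j _.
  by rewrite mxadjZ mxadjM mxadjK.
have -> : H = 2^-1%:C *: (H + H).
  rewrite scalerDr -scalerDl (_ : 2^-1%:C + 2^-1%:C = 1) ?scale1r //.
  by apply/eqP; rewrite eq_complex /=; apply/andP; split; apply/eqP; field.
rewrite {1}ec ec' -big_split /= scaler_sumr; apply: eq_bigr => i _.
rewrite -big_split /= scaler_sumr; apply: eq_bigr => j _.
by rewrite -scalerDl scalerA mxE.
Qed.

(** The channel resetting every input to the first basis state; it makes the set behind [qec_eps]
    nonempty. *)
Lemma recovery_exists m n : (0 < n)%N -> exists Rk : seq 'M[C]_(n, m), kraus_tp Rk.
Proof.
case: n => // n _; exists [seq delta_mx ord0 j | j <- enum 'I_m].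
rewrite /kraus_tp big_map big_enum /=.
under eq_bigr => j _ do rewrite mxadj_delta mul_delta_mx.
by rewrite [RHS]mx1_sum_delta.
Qed.

Lemma deltaG_ge0 dL dS (HL : 'M[C]_dL) (HS : 'M[C]_dS) (V : 'M[C]_(dS, dL)) :
  0 <= deltaG HL HS V.
Proof.
apply: le_trans (chan_pdist_ge0 [:: Uop HS 0 *m V] [:: V *m Uop HL 0]) _.
by apply: ub_le_sup; [exists 1 => _ [t ->]; exact: chan_pdist_le1 | exists 0].
Qed.

Lemma qec_bound dL dS k (V : 'M[C]_(dS, dL)) (K : 'I_k -> 'M[C]_dS) (H : 'M[C]_dS)
    (e : bool -> 'cV[C]_dL) : (0 < dL)%N -> (0 < dS)%N ->
  mxadj V *m V = 1%:M -> kraus_tp (kraus_seq K) -> herm_mx H -> in_kraus_span K H ->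
  (forall b, mxadj (e b) *m e b = 1%:M) ->
  energy V H (e true) - energy V H (e false) <= 2 * qec_eps V K * frakJ K H.
Proof.
move=> dL0 dS0 VV KK hH span ee.
(* An empty Kraus family would sum to 0 instead of the identity. *)
have k0 : (0 < k)%N.
  case: k K KK span => // K /kraus_tp_fun; rewrite big_ord0 => /matrixP /(_ (Ordinal dS0) (Ordinal dS0)).
  by rewrite !mxE eqxx => /eqP; rewrite eq_sym oner_eq0.
have S0 : exists x : R, exists Rk : seq 'M[C]_(dL, dS), kraus_tp Rk /\
    x = chan_pdist (kraus_comp Rk (kraus_comp (kraus_seq K) [:: V])) [:: 1%:M].
  have [Rk hR] := @recovery_exists dS _ dL0.
  by exists (chan_pdist (kraus_comp Rk (kraus_comp (kraus_seq K) [:: V])) [:: 1%:M]), Rk.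
have eps0 : 0 <= qec_eps V K.
  by apply: lb_le_inf => // _ [Rk [_ ->]]; exact: chan_pdist_ge0.
rewrite mulrC; apply: le_mul_inf; rewrite ?mulr_ge0 //.
  by have [h [hh eh]] := kraus_span_herm hH span; exists (Delta h), h.
move=> _ [h [hh [eh ->]]].
have D0 : 0 <= Delta h by exact: Delta_ge0.
rewrite (_ : Delta h * _ = qec_eps V K * (2 * Delta h)); last by ring.
apply: le_mul_inf; rewrite ?mulr_ge0 // => _ [Rk [hR ->]].
rewrite mulrCA mulrA; exact: qec_gap.
Qed.

End MainBounds.

Theorem theorem1 (R : realType) :
  exists ell : R -> R,
    (exists (c r : R), 0 < r /\
       forall y : R, `|y| <= r -> `|ell y - y| <= c * y ^+ 2) /\
    forall (dL dS k : nat) (V : 'M[complex R]_(dS, dL)) (K : 'I_k -> 'M[complex R]_dS)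
           (HL : 'M[complex R]_dL) (HS : 'M[complex R]_dS),
      (0 < dL)%N -> (0 < dS)%N ->
      mxadj V *m V = 1%:M ->
      kraus_tp (kraus_seq K) ->
      herm_mx HL -> herm_mx HS ->
      nontrivial HL -> nontrivial HS ->
      in_kraus_span K HS ->
      ell (Num.sqrt ((Delta HL - 2 * qec_eps V K * frakJ K HS) / Delta HS))
        <= deltaG HL HS V.
Proof.
(* y - y^2 <= 1/4, so the bound only has content when deltaG < 1/4. *)
exists (fun y => y - y ^+ 2); split.
  exists 1, 1; split=> // y _.
  by rewrite addrC addKr normrN mul1r ger0_norm // sqr_ge0.
move=> dL dS k V K HL HS dL0 dS0 VV KK hL hS ntL ntS span.
have DS0 := Delta_gt0 dS0 hS ntS.
have d0 := deltaG_ge0 HL HS V.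
set q := _ / _; set y := Num.sqrt q.
have y0 : 0 <= y by exact: sqrtr_ge0.
have [big|small] := leP (1 / 4) (deltaG HL HS V).
  by apply: le_trans big; have := sqr_ge0 (y - 1 / 2); nra.
have [e [eta [ee /andP[eta0 eta1] heta gap]]] := covariance_gap dL0 dS0 VV hL hS small.
have chi := qec_bound dL0 dS0 VV KK hS span ee.
(* [Num.sqrt] vanishes on nonpositive arguments, so y = 0 here. *)
have [q0|q0] := leP q 0.
  by rewrite /y ler0_sqrtr // expr0n subrr.
have yq : y ^+ 2 = q by rewrite sqr_sqrtr // ltW.
have y2 : y ^+ 2 <= 2 * eta.
  by rewrite yq /q ler_pdivrMr //; lra.
have y1 : y <= 1 by nra.
have [neg|pos] := leP (y - y ^+ 2) 0; first by apply: le_trans neg _.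
rewrite -ler_sqr ?nnegrE ?(ltW pos) //.
apply: le_trans heta.
(* x -> 2 x (1 - x) increases on [0, 1/2]; it is compared at x = y^2 / 2 and at eta. *)
have h1 : y ^+ 2 - (y ^+ 2) ^+ 2 / 2 <= 2 * eta * (1 - eta).
  move: (y ^+ 2) (sqr_ge0 y) y2 => u u0 u2; nra.
apply: le_trans h1.
(* The subtracted remainder is nonnegative because y <= 1. *)
have -> : (y - y ^+ 2) ^+ 2 = y ^+ 2 - (y ^+ 2) ^+ 2 / 2 - y ^+ 3 * (2 - 3 / 2 * y) by field.
by rewrite lerBlDr lerDl mulr_ge0 ?exprn_ge0 //; lra.
Qed.
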